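(* For every $\varepsilon>0$ there exists $N$ such that the following holds. Let $I_1$ and $I_2$ be two disjoint intervals of positive integers, of respective cardinalities $n_1$ and $n_2$, with $n_1+n_2\geqslant N$. Then $$F(I_1\cup I_2)\geqslant (0.876-\varepsilon)\sqrt{n_1+n_2}.$$ Equivalently, $F(I_1\cup I_2)\geqslant (1-o(1))\,0.876\sqrt{n_1+n_2}$ as $n_1+n_2\to\infty$.
   Context: A Sidon set is a set $S$ of integers such that whenever $a,b,c,d\in S$ satisfy $a+b=c+d$, we have $\{a,b\}=\{c,d\}$ (i.e. all sums of two elements of $S$ are distinct). For a finite set $A\subseteq\mathbb{N}$, $F(A)$ denotes the maximal cardinality of a Sidon set contained in $A$. An interval of integers means a set of the form $\{a,a+1,\dots,b\}$. *)

(* Defs.v *)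
From mathcomp Require Import all_boot all_order all_algebra.
From mathcomp Require Import finmap.
From mathcomp Require Import boolp reals.

Set Implicit Arguments.
Unset Strict Implicit.
Unset Printing Implicit Defensive.

Local Open Scope fset_scope.

Definition sidon (S : {fset nat}) : Prop :=
  forall a b c d : nat, a \in S -> b \in S -> c \in S -> d \in S ->
    (a + b = c + d)%N -> [fset a; b] = [fset c; d].

Definition max_sidon (A : {fset nat}) : nat :=
  \max_(S <- fpowerset A | `[< sidon S >]) #|` S|.

(* {a, a + 1, ..., b}; empty when b < a. *)
Definition nat_interval (a b : nat) : {fset nat} := [fset k in iota a (b.+1 - a)].

Definition is_pos_interval (I : {fset nat}) : Prop :=
  exists a b : nat, (0 < a)%N /\ I = nat_interval a b.

(* Main.v *)
(**
Ruzsa's set of the residues x modulo p(p - 1) with x = g^x in F_p (g a primitive root) is a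
Sidon set of p - 1 elements, so averaging over its translates puts a Sidon set of size at least
|X| / p inside every X that is injective modulo p(p - 1).  Let n = n1 + n2 and let H be the
length of the convex hull of the two intervals.  With c slightly above 0.876^2 (c = 33/43
works), three choices cover all cases: X the whole union when c H <= n; X one interval when it
has at least c n elements; and otherwise X an interval of length b1 + b2, cut into two pieces
that are moved to the far ends of the two intervals.  The last choice preserves the Sidon
property as soon as the remaining gap is at least max(b1, b2), because then the sums of type
1+1, 1+2 and 2+2 do not meet.  The constant comes from the corner a (1 + g) = 1, 3 a = 2 + g
where the three choices tie, which gives a = (1 + sqrt 13) / 6 and sqrt a = 0.8761...

This needs primes p in (x, (1 + d) x] for every d > 0 and all large x.  They are obtained from
Selberg's symmetry formula, proved by the Tatuzawa-Iseki inversion, through an argument of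
Erdős: if the logarithmic interval (u, u + h] carries almost no mass of Lambda(n) / n, the
formula forces (u - log n, u - log n + h] to carry nearly the maximal mass 2 h for almost all n;
chaining such intervals produces a long interval of density above 1, against Mertens.
*)

From mathcomp Require Import all_boot all_order all_algebra.
From mathcomp Require Import finmap.
From mathcomp Require Import boolp reals sequences exp.
From mathcomp Require Import cyclic finfield.
From mathcomp Require Import ring lra zify.
Require Import Defs.

Set Implicit Arguments.
Unset Strict Implicit.
Unset Printing Implicit Defensive.

Import Order.TTheory GRing.Theory Num.Theory.
Local Open Scope fset_scope.
Local Open Scope ring_scope.

(** * Divisor sums, the von Mangoldt and Möbius functions *)

Definition divisor_sum (R : nmodType) (f : nat -> R) (m : nat) : R :=
  \sum_(1 <= d < m.+1 | (d %| m)%N) f d.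

Lemma divisor_sum_widen (R : nmodType) (f : nat -> R) (m N : nat) :
  (0 < m <= N)%N ->
  divisor_sum f m = \sum_(1 <= d < N.+1 | (d %| m)%N) f d.
Proof.
move=> /andP[m_gt0 le_mN]; rewrite /divisor_sum.
rewrite [RHS](@big_cat_nat _ _ _ m.+1) //=.
rewrite [X in _ + X]big_nat_cond [X in _ + X]big1 ?addr0 // => d.
move=> /andP[/andP[lt_md _] /dvdn_leq]; lia.
Qed.

Lemma perm_multiples (d N : nat) : (0 < d)%N ->
  perm_eq [seq m <- index_iota 1 N.+1 | d %| m]%N
          [seq d * k | k <- index_iota 1 (N %/ d).+1]%N.
Proof.
move=> d_gt0; apply: uniq_perm.
- by rewrite filter_uniq // iota_uniq.
- rewrite map_inj_uniq ?iota_uniq // => i j /eqP.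
  by rewrite eqn_pmul2l // => /eqP.
move=> m; rewrite mem_filter mem_index_iota; apply/idP/mapP.
  move=> /andP[/dvdnP[k ->] /andP[m_gt0 m_le]]; exists k; last by rewrite mulnC.
  rewrite mem_index_iota ltnS leq_divRL //; move: m_gt0; rewrite muln_gt0.
  by case/andP=> -> _ /=; rewrite -ltnS.
move=> [k]; rewrite mem_index_iota ltnS leq_divRL // => /andP[k_gt0 k_le] ->.
by rewrite dvdn_mulr // muln_gt0 d_gt0 k_gt0 /= ltnS mulnC.
Qed.

Lemma sum_multiples (R : nmodType) (F : nat -> R) (d N : nat) : (0 < d)%N ->
  \sum_(1 <= m < N.+1 | (d %| m)%N) F m =
  \sum_(1 <= k < (N %/ d).+1) F (d * k)%N.
Proof.
move=> d_gt0; rewrite -big_filter (perm_big _ (perm_multiples N d_gt0)) /=.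
by rewrite big_map.
Qed.

(** Pairs [d | m <= N] are reparametrised as [m = d * k] with [k <= N / d]. [F] sees both the
    divisor and the multiple, so Dirichlet convolutions are covered. *)
Lemma sum_divisor_sum (R : nmodType) (F : nat -> nat -> R) (N : nat) :
  \sum_(1 <= m < N.+1) divisor_sum (F^~ m) m =
  \sum_(1 <= d < N.+1) \sum_(1 <= k < (N %/ d).+1) F d (d * k)%N.
Proof.
transitivity (\sum_(1 <= m < N.+1) \sum_(1 <= d < N.+1 | (d %| m)%N) F d m).
  by rewrite !big_nat; apply: eq_bigr => m Hm; rewrite (@divisor_sum_widen _ _ _ N) //; lia.
rewrite (exchange_big_dep predT) //= !big_nat; apply: eq_bigr => d /andP[d_gt0 _].
exact: sum_multiples.
Qed.

Lemma divisor_sum_rev (R : nmodType) (F : nat -> R) (m : nat) : (0 < m)%N ->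
  divisor_sum F m = divisor_sum (fun d => F (m %/ d)%N) m.
Proof.
move=> m_gt0; rewrite /divisor_sum -big_filter -[RHS]big_filter.
set s := filter _ _.
have memE d : (d \in s) = (d %| m)%N.
  rewrite mem_filter mem_index_iota; case: (boolP (d %| m)%N) => //= dm.
  by have := dvdn_leq m_gt0 dm; have := dvdn_gt0 m_gt0 dm; lia.
have us : uniq s by rewrite filter_uniq // iota_uniq.
rewrite -(big_map (fun d => m %/ d)%N predT F); apply: perm_big.
apply: uniq_perm => //.
  rewrite map_inj_in_uniq // => i j; rewrite !memE => im jm e.
  have q0 : (0 < m %/ j)%N by rewrite divn_gt0 ?(dvdn_gt0 m_gt0 jm) ?(dvdn_leq m_gt0 jm).
  by apply/eqP; rewrite -(eqn_pmul2l q0) (divnK jm) -e (divnK im).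
move=> d; rewrite memE; apply/idP/mapP => [dm|[e]].
  exists (m %/ d)%N; first by rewrite memE dvdn_div.
  have q0 : (0 < m %/ d)%N by rewrite divn_gt0 ?(dvdn_gt0 m_gt0 dm) ?(dvdn_leq m_gt0 dm).
  by apply/eqP; rewrite eqn_div ?dvdn_div // mulnC divnK.
by rewrite memE => em ->; rewrite dvdn_div.
Qed.

(** Prime powers are recognised as the [n > 1] equal to the full power of their least prime
    factor. *)
Definition von_mangoldt (R : realType) (n : nat) : R :=
  if (1 < n)%N && (n == pdiv n ^ logn (pdiv n) n)%N then ln (pdiv n)%:R else 0.

Definition moebius (R : realType) (n : nat) : R :=
  if (0 < n)%N && all (fun p => logn p n == 1)%N (primes n)
  then (-1) ^+ size (primes n) else 0.

Lemma von_mangoldt_ge0 (R : realType) n : 0 <= von_mangoldt R n.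
Proof.
rewrite /von_mangoldt; case: ifP => // _.
by apply: ln_ge0; rewrite ler1n pdiv_gt0.
Qed.

Lemma von_mangoldt_le (R : realType) n : (0 < n)%N -> von_mangoldt R n <= ln n%:R.
Proof.
move=> n_gt0; rewrite /von_mangoldt; case: ifP => _; last by apply: ln_ge0; rewrite ler1n.
by rewrite ler_ln ?posrE ?ltr0n ?pdiv_gt0 // ler_nat pdiv_leq.
Qed.

Lemma von_mangoldtX (R : realType) p k : prime p ->
  von_mangoldt R (p ^ k.+1) = ln p%:R.
Proof.
move=> pp; rewrite /von_mangoldt pdiv_pfactor // pfactorK // eqxx andbT.
by rewrite -(exp1n k.+1) ltn_exp2r // prime_gt1.
Qed.

(** Both [p] and [pdiv e] divide the product and they differ, whereas a prime power has a single
    prime divisor. *)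
Lemma von_mangoldt_coprime (R : realType) p k e : prime p -> (0 < k)%N ->
  ~~ (p %| e)%N -> e != 1%N -> von_mangoldt R (p ^ k * e) = 0.
Proof.
move=> pp k_gt0 pe e1; rewrite /von_mangoldt; case: ifP => // /andP[gt1 /eqP E].
have [e0|e_gt0] := posnP e; first by rewrite e0 dvdn0 in pe.
have epr : prime (pdiv e) by rewrite pdiv_prime //; lia.
have pne : pdiv e != p by apply/negP => /eqP ep; rewrite -ep pdiv_dvd in pe.
have qpr : prime (pdiv (p ^ k * e)) by rewrite pdiv_prime.
have h r : prime r -> (r %| p ^ k * e)%N -> r = pdiv (p ^ k * e).
  by move=> rp; rewrite {1}E Euclid_dvdX // => /andP[/prime_nt_dvdP -> //]; rewrite neq_ltn prime_gt1 ?orbT.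
have h1 := h _ pp (dvdn_mulr _ (dvdn_exp k_gt0 (dvdnn p))).
have h2 := h _ epr (dvdn_mull _ (pdiv_dvd e)).
by rewrite h2 -h1 eqxx in pne.
Qed.

(** Strong induction, dividing [m] by its least prime [p]: the divisors of [m] that do not divide
    [m / p] contain the full power [p ^ k], and among them only [p ^ k] itself is a prime power; it
    contributes [ln p]. *)
Lemma divisor_sum_von_mangoldt (R : realType) m : (0 < m)%N ->
  divisor_sum (von_mangoldt R) m = ln m%:R.
Proof.
elim/ltn_ind: m => m IH m_gt0.
have [m1|m_gt1] := leqP m 1.
  have -> : m = 1%N by lia.
  by rewrite /divisor_sum big_mkcond big_nat1 /= ln1 /von_mangoldt.
set p := pdiv m; have pp : prime p by exact: pdiv_prime.
have pm : (p %| m)%N by exact: pdiv_dvd.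
set k := logn p m.
have k_gt0 : (0 < k)%N by rewrite /k -pfactor_dvdn // expn1.
set m1 := (m %/ p)%N.
have mE : m = (m1 * p)%N by rewrite divnK.
have m1_gt0 : (0 < m1)%N by rewrite divn_gt0 ?prime_gt0 // dvdn_leq.
have m1m : (m1 < m)%N by rewrite ltn_Pdiv // prime_gt1.
have pkm : (p ^ k %| m)%N by rewrite /k pfactor_dvdnn.
have km1 : logn p m1 = k.-1 by rewrite /k mE lognM // ?(prime_gt0 pp) // (logn_prime _ pp) eqxx addn1.
have pkm1 : ~~ (p ^ k %| m1)%N by rewrite pfactor_dvdn // km1 -ltnNge prednK.
have -> : ln m%:R = ln m1%:R + ln p%:R :> R.
  by rewrite {1}mE natrM lnM ?posrE ?ltr0n // prime_gt0.
rewrite -(IH m1) //.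
rewrite (@divisor_sum_widen _ _ m1 m); last lia.
rewrite /divisor_sum (bigID (fun d => d %| m1)%N) /=; congr (_ + _).
  by apply: eq_bigl => d; apply/andP/idP => [[]//|dm1]; split=> //; rewrite mE dvdn_mulr.
rewrite big_mkcond (bigD1_seq (p ^ k)%N) ?iota_uniq //=; last first.
  by rewrite mem_index_iota expn_gt0 prime_gt0 //= ltnS dvdn_leq.
rewrite pkm pkm1 /= -(prednK k_gt0) von_mangoldtX // big1 ?addr0 // => d dpk.
case: ifP => // /andP[dm dm1].
have d_gt0 := dvdn_gt0 m_gt0 dm.
have [e cpe dE] := pfactor_coprime pp d_gt0.
have pe : ~~ (p %| e)%N by rewrite -prime_coprime.
have jk : (logn p d <= k)%N by apply: dvdn_leq_log.
have [jlt|jge] := ltnP (logn p d) k.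
  have em1 : (e %| m1)%N.
    rewrite -(@Gauss_dvdl _ _ p) 1?coprime_sym // -mE.
    by apply: dvdn_trans dm; apply/dvdnP; exists (p ^ logn p d)%N; rewrite mulnC.
  have pm1 : (p ^ logn p d %| m1)%N by rewrite pfactor_dvdn // km1 -ltnS prednK.
  have cop : coprime e (p ^ logn p d) by rewrite coprimeXr // coprime_sym.
  have : (e * p ^ logn p d %| m1)%N by rewrite Gauss_dvd // em1.
  by rewrite -dE (negbTE dm1).
have jE : logn p d = k by apply/eqP; rewrite eqn_leq jk.
rewrite dE jE mulnC von_mangoldt_coprime //; apply: contraNneq dpk => e1.
by rewrite dE e1 jE mul1n (prednK k_gt0).
Qed.

Lemma moebius1 (R : realType) : moebius R 1 = 1.
Proof. by rewrite /moebius /= expr0. Qed.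

Lemma norm_moebius_le1 (R : realType) n : `|moebius R n| <= 1.
Proof.
rewrite /moebius; case: ifP => _; last by rewrite normr0.
by rewrite normrX normrN1 expr1n.
Qed.

Lemma moebius_mul_dvd (R : realType) p e : prime p -> (0 < e)%N ->
  (p %| e)%N -> moebius R (p * e) = 0.
Proof.
move=> pp e_gt0 pe; rewrite /moebius; case: ifP => // /andP[_ /allP /(_ p)].
rewrite mem_primes pp muln_gt0 prime_gt0 // e_gt0 dvdn_mulr // => /(_ isT).
rewrite lognM // ?(prime_gt0 pp) // (logn_prime _ pp) eqxx => /eqP.
have : (0 < logn p e)%N by rewrite -pfactor_dvdn // expn1.
by lia.
Qed.

Lemma moebius_mul_prime (R : realType) p e : prime p -> (0 < e)%N ->
  ~~ (p %| e)%N -> moebius R (p * e) = - moebius R e.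
Proof.
move=> pp e_gt0 pe.
have perm : perm_eq (primes (p * e)) (p :: primes e).
  apply: uniq_perm => [||q]; first exact: primes_uniq.
    by rewrite /= primes_uniq mem_primes (negbTE pe) !andbF.
  by rewrite primesM // ?(prime_gt0 pp) // primes_prime // !inE.
rewrite /moebius (perm_size perm) (perm_all _ perm) /= muln_gt0 prime_gt0 // e_gt0 /=.
have lp : logn p e = 0%N by apply/eqP; rewrite -leqn0 leqNgt -pfactor_dvdn // expn1.
rewrite lognM // ?(prime_gt0 pp) // (logn_prime _ pp) eqxx lp /=.
have -> : all (fun q => logn q (p * e) == 1%N) (primes e) =
          all (fun q => logn q e == 1%N) (primes e).
  apply: eq_in_all => q; rewrite mem_primes => /and3P[qp _ qe].
  rewrite lognM // ?(prime_gt0 pp) // (logn_prime _ pp).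
  by case: (q =P p) => // qE; rewrite -qE qe in pe.
by case: ifP => _; rewrite ?oppr0 // exprS mulN1r.
Qed.

(** For [p] the least prime of [m] and [m1 = m / p], the divisors prime to [p] are divisors of [m1],
    and the others are [p * k] with [k | m1]. The terms at [k] and [p * k] cancel if [p] does not
    divide [k]; otherwise the term at [p * k] is 0. *)
Lemma divisor_sum_moebius (R : realType) m : (0 < m)%N ->
  divisor_sum (moebius R) m = (m == 1)%N%:R.
Proof.
move=> m_gt0; have [m1|m_gt1] := leqP m 1.
  have -> : m = 1%N by lia.
  by rewrite /divisor_sum big_mkcond big_nat1 /= moebius1.
have -> : (m == 1)%N = false by lia.
set p := pdiv m; have pp : prime p by exact: pdiv_prime.
have pm : (p %| m)%N by exact: pdiv_dvd.
have p_gt0 := prime_gt0 pp.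
set m1 := (m %/ p)%N.
have mE : m = (p * m1)%N by rewrite mulnC divnK.
have m1_gt0 : (0 < m1)%N by rewrite divn_gt0 // dvdn_leq.
rewrite /divisor_sum (bigID (fun d => p %| d)%N) /=.
rewrite (eq_bigl (fun d => (p %| d)%N && (d %| m)%N)) => [|d]; last exact: andbC.
rewrite big_mkcondr /= sum_multiples // -/m1.
have -> : \sum_(1 <= k < m1.+1) (if (p * k %| m)%N then moebius R (p * k) else 0) =
          \sum_(1 <= k < m1.+1 | (k %| m1)%N) moebius R (p * k).
  rewrite [RHS]big_mkcond; apply: eq_bigr => k _.
  by rewrite [in X in (_ %| X)%N]mE dvdn_pmul2l.
have -> : \sum_(1 <= d < m.+1 | (d %| m)%N && ~~ (p %| d)%N) moebius R d =
          \sum_(1 <= d < m1.+1 | (d %| m1)%N && ~~ (p %| d)%N) moebius R d.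
  rewrite !big_mkcondr /= -!/(divisor_sum _ _) (@divisor_sum_widen _ _ m1 m); last first.
    by rewrite m1_gt0 leq_div.
  rewrite /divisor_sum [LHS]big_mkcond [RHS]big_mkcond; apply: eq_bigr => d _.
  case: (boolP (p %| d)%N) => /= pd; first by do 2!case: ifP.
  by rewrite mE Gauss_dvdr // coprime_sym prime_coprime.
rewrite (bigID (fun d => p %| d)%N) /= [X in X + _ + _]big1_seq ?add0r.
  rewrite -big_split big1_seq //= => k; rewrite mem_index_iota => /andP[/andP[km pk] /andP[k0 _]].
  by rewrite moebius_mul_prime // addNr.
move=> k; rewrite mem_index_iota => /andP[/andP[km pk] /andP[k0 _]].
exact: moebius_mul_dvd.
Qed.

(** Write [ln d = ln m - ln (m / d)]. The first part vanishes; in the second, [ln (m / d)] is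
    expanded into values of [von_mangoldt] at [e], and after the exchange the inner Möbius sum over
    the divisors of [m / e] survives only for [e = m]. *)
Lemma divisor_sum_moebius_ln (R : realType) m : (0 < m)%N ->
  divisor_sum (fun d => moebius R d * ln d%:R) m = - von_mangoldt R m.
Proof.
move=> m_gt0.
have lnE d : (0 < d)%N -> (d %| m)%N -> ln d%:R = ln m%:R - ln (m %/ d)%:R :> R.
  move=> d0 dm; rewrite -{1}(divnK dm) natrM lnM ?posrE ?ltr0n //; first lra.
  by rewrite divn_gt0 // dvdn_leq.
have -> : divisor_sum (fun d => moebius R d * ln d%:R) m =
   ln m%:R * divisor_sum (moebius R) m
   - divisor_sum (fun d => moebius R d * ln (m %/ d)%:R) m.
  rewrite /divisor_sum mulr_sumr -sumrB big_nat_cond [RHS]big_nat_cond; apply: eq_bigr => d.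
  by move=> /andP[/andP[d0 _] dm]; rewrite lnE //; ring.
rewrite divisor_sum_moebius // [X in X - _](_ : _ = 0); last first.
  by case: eqP => [->|_]; rewrite ?ln1 ?mul0r ?mulr0.
rewrite sub0r; congr (- _).
(* Extension by zero lets [e] and [d] both run over the full range, so that the sums can be
   exchanged freely. *)
pose F e d : R := if (e * d %| m)%N then moebius R d * von_mangoldt R e else 0.
transitivity (\sum_(1 <= d < m.+1) \sum_(1 <= e < m.+1) F e d).
  rewrite /divisor_sum big_mkcond !big_nat; apply: eq_bigr => d /andP[d0 dm].
  case: ifP => dvd; last first.
    rewrite big1 // => e _; rewrite /F; case: ifP => // h.
    by rewrite (dvdn_trans _ h) // dvdn_mull in dvd.
  have q0 : (0 < m %/ d)%N by rewrite divn_gt0 // dvdn_leq.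
  rewrite -divisor_sum_von_mangoldt // (@divisor_sum_widen _ _ _ m); last by rewrite q0 leq_div.
  rewrite mulr_sumr big_mkcond; apply: eq_bigr => e _.
  by rewrite /F dvdn_divRL // mulnC; case: ifP.
rewrite exchange_big /= (bigD1_seq m) ?iota_uniq ?mem_index_iota ?m_gt0 ?ltnSn //=.
rewrite big_nat_recl // big_nat /F muln1 dvdnn moebius1 mul1r big1 ?addr0; last first.
  move=> d /andP[d0 _]; case: ifP => // /(dvdn_leq m_gt0).
  by rewrite -{2}(muln1 m) leq_pmul2l // ltnNge d0.
rewrite big1_seq ?addr0 // => e; rewrite mem_index_iota => /andP[em /andP[e0 _]].
case: (boolP (e %| m)%N) => [dvd|ndvd]; last first.
  rewrite big1 // => d _; case: ifP => // h.
  by rewrite (dvdn_trans _ h) // dvdn_mulr in ndvd.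
have q0 : (0 < m %/ e)%N by rewrite divn_gt0 // dvdn_leq.
transitivity (von_mangoldt R e * divisor_sum (moebius R) (m %/ e)).
  rewrite (@divisor_sum_widen _ _ _ m); last by rewrite q0 leq_div.
  rewrite mulr_sumr [RHS]big_mkcond; apply: eq_bigr => d _.
  by rewrite dvdn_divRL // mulnC; case: ifP; rewrite 1?mulrC.
rewrite divisor_sum_moebius //; case: eqP => [h|_]; last by rewrite mulr0.
by case/eqP: em; rewrite -(divnK dvd) h mul1n.
Qed.

(** * Estimates of Chebyshev and Mertens *)

Lemma ln_sub_le (R : realType) (x y : R) : 0 < x -> 0 < y -> ln y - ln x <= (y - x) / x.
Proof.
move=> x0 y0; rewrite -ln_div ?posrE //.
have -> : y / x = 1 + (y - x) / x by field; rewrite gt_eqF.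
apply: le_ln1Dx; rewrite ltr_pdivlMr // mulN1r; lra.
Qed.

Lemma ln_natS_le (R : realType) n : (0 < n)%N ->
  ln n.+1%:R - ln n%:R <= n%:R^-1 :> R.
Proof.
move=> n0; apply: le_trans (ln_sub_le _ _) _; rewrite ?ltr0n //.
by rewrite -natr1 addrAC subrr add0r mul1r.
Qed.

Lemma ln_natS_ge (R : realType) n : (0 < n)%N ->
  n.+1%:R^-1 <= ln n.+1%:R - ln n%:R :> R.
Proof.
move=> n0; have := @ln_sub_le R n.+1%:R n%:R; rewrite !ltr0n n0 => /(_ isT isT).
have -> : (n%:R - n.+1%:R) / n.+1%:R = - (n.+1%:R^-1) :> R by rewrite -natr1; field; rewrite natr1 pnatr_eq0.
by rewrite lerNr opprB.
Qed.

Lemma ln_nat_ge0 (R : realType) n : 0 <= ln n%:R :> R.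
Proof. by case: n => [|n]; [rewrite ln0 | apply: ln_ge0; rewrite ler1n]. Qed.

Lemma ln_nat_le (R : realType) n : ln n%:R <= n%:R :> R.
Proof. by case: n => [|n]; [rewrite ln0 | apply: ltW; apply: ln_sublinear; rewrite ltr0n]. Qed.

Lemma ler_ln_nat (R : realType) m n : (0 < m)%N -> (m <= n)%N -> ln m%:R <= ln n%:R :> R.
Proof. by move=> m0 mn; rewrite ler_ln ?posrE ?ltr0n ?ler_nat //; lia. Qed.

Definition chebyshev_psi (R : realType) N : R := \sum_(1 <= n < N.+1) von_mangoldt R n.
Definition ln_fact (R : realType) N : R := \sum_(1 <= n < N.+1) ln n%:R.
Definition mertens (R : realType) N : R :=
  \sum_(1 <= n < N.+1) von_mangoldt R n / n%:R.
Definition harmonic (R : realType) N : R := \sum_(1 <= n < N.+1) n%:R^-1.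

Lemma sum1S (R : nmodType) (F : nat -> R) N :
  \sum_(1 <= n < N.+2) F n = \sum_(1 <= n < N.+1) F n + F N.+1.
Proof. by rewrite big_nat_recr. Qed.

Lemma chebyshev_psi_ge0 (R : realType) N : 0 <= chebyshev_psi R N.
Proof. by apply: sumr_ge0 => n _; exact: von_mangoldt_ge0. Qed.

Lemma ln_fact_ge (R : realType) N : N%:R * ln N%:R - N%:R <= ln_fact R N.
Proof.
elim: N => [|N IH]; first by rewrite /ln_fact big_geq // mul0r subrr.
rewrite /ln_fact sum1S -/(ln_fact R N).
have [->|N0] := posnP N; first by rewrite /ln_fact big_geq // ln1; lra.
have := ln_natS_le R N0; rewrite -(ler_pM2l (_ : 0 < N%:R)) ?ltr0n // divff ?pnatr_eq0 -?lt0n //.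
by rewrite -[N.+1%:R]natr1; nra.
Qed.

Lemma ln_fact_le (R : realType) N : (0 < N)%N ->
  ln_fact R N <= N%:R * ln N%:R - N%:R + ln N%:R + 1.
Proof.
case: N => // N _; elim: N => [|N IH]; first by rewrite /ln_fact big_nat1 ln1; lra.
rewrite /ln_fact sum1S -/(ln_fact R _).
have := ln_natS_ge R (ltn0Sn N); rewrite -(ler_pM2l (_ : 0 < N.+2%:R)) ?ltr0n // divff ?pnatr_eq0 //.
by move: IH; rewrite -[N.+2%:R]natr1; nra.
Qed.

Lemma ln_fact_sum_floor (R : realType) N :
  ln_fact R N = \sum_(1 <= d < N.+1) von_mangoldt R d * (N %/ d)%:R.
Proof.
transitivity (\sum_(1 <= m < N.+1) divisor_sum (von_mangoldt R) m).
  by rewrite /ln_fact !big_nat; apply: eq_bigr => m /andP[m0 _]; rewrite divisor_sum_von_mangoldt.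
rewrite (sum_divisor_sum (fun d _ => von_mangoldt R d)); apply: eq_bigr => d _.
by rewrite big_const_nat iter_addr_0 subn1 mulr_natr.
Qed.

(** The double sum behind [ln_fact_sum_floor], grouped by the complementary divisor. *)
Lemma ln_fact_sum_psi (R : realType) N :
  ln_fact R N = \sum_(1 <= n < N.+1) chebyshev_psi R (N %/ n).
Proof.
transitivity (\sum_(1 <= m < N.+1) divisor_sum (fun d => von_mangoldt R (m %/ d)) m).
  rewrite /ln_fact !big_nat; apply: eq_bigr => m /andP[m0 _].
  by rewrite -divisor_sum_rev // divisor_sum_von_mangoldt.
rewrite (sum_divisor_sum (fun d m => von_mangoldt R (m %/ d))) !big_nat.
apply: eq_bigr => d /andP[d0 _]; apply: eq_bigr => k _.
by rewrite mulKn.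
Qed.

(** On the right [von_mangoldt R d] has coefficient [N / d - 2 * (N / 2 / d)], which is never
    negative and is at least 1 for [N / 2 < d <= N]. *)
Lemma chebyshev_psi_half (R : realType) N :
  chebyshev_psi R N - chebyshev_psi R (N %/ 2) <= ln_fact R N - 2 * ln_fact R (N %/ 2).
Proof.
set M := (N %/ 2)%N; have MN : (M <= N)%N by exact: leq_div.
have ext (F : nat -> R) : \sum_(1 <= d < M.+1) F d = \sum_(1 <= d < N.+1) (if (d <= M)%N then F d else 0).
  rewrite [RHS](@big_cat_nat _ _ _ M.+1) //= ?ltnS // [X in _ + X]big_nat [X in _ + X]big1 ?addr0.
    by rewrite !big_nat; apply: eq_bigr => d /andP[_]; rewrite ltnS => ->.
  by move=> d /andP[h _]; rewrite leqNgt h.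
rewrite !ln_fact_sum_floor /chebyshev_psi !ext mulr_sumr -!sumrB !big_nat; apply: ler_sum => d /andP[d0 dN].
have L0 := von_mangoldt_ge0 R d.
have Md : (M %/ d = N %/ d %/ 2)%N by rewrite /M divnAC.
case: ifP => dM.
  rewrite subrr Md mulrCA -mulrBr; apply: mulr_ge0 => //.
  by rewrite subr_ge0 -natrM ler_nat; lia.
rewrite subr0 mulr0 subr0 -{1}(mulr1 (von_mangoldt R d)); apply: ler_wpM2l => //.
by rewrite ler1n divn_gt0.
Qed.

Lemma ln_fact_half (R : realType) N : ln_fact R N - 2 * ln_fact R (N %/ 2) <= 5 * N%:R.
Proof.
have [->|N0] := posnP N; first by rewrite /ln_fact div0n !big_geq //; lra.
have [N1|N2] := leqP N 1.
  have -> : N = 1%N by lia.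
  by rewrite /ln_fact big_nat1 big_geq // ln1; lra.
set M := (N %/ 2)%N; have M0 : (0 < M)%N by rewrite /M; lia.
have Mle : (M.*2 <= N)%N by rewrite /M; lia.
have Mge : (N <= M.*2.+1)%N by rewrite /M; lia.
have lnN : ln N%:R <= ln M%:R + 2 :> R.
  have := @ln_sub_le R M%:R N%:R; rewrite !ltr0n M0 N0 => /(_ isT isT) h.
  suff : (N%:R - M%:R) / M%:R <= 2 :> R by lra.
  by rewrite ler_pdivrMr ?ltr0n // lerBlDr -natrM -natrD ler_nat; lia.
have U := ln_fact_le R N0; have L := ln_fact_ge R M.
have l0 := ln_nat_ge0 R M; have l1 := ln_nat_le R N.
have lMN : ln M%:R <= ln N%:R :> R by rewrite ler_ln_nat //; lia.
have h1 : 2 * M%:R <= N%:R :> R by rewrite -natrM ler_nat; lia.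
have h2 : N%:R <= 2 * M%:R + 1 :> R by rewrite -natrM natr1 ler_nat; lia.
have N1 : 1 <= N%:R :> R by rewrite ler1n.
have hm : N%:R * ln N%:R <= N%:R * (ln M%:R + 2) :> R by apply: ler_wpM2l.
have hm2 : (N%:R - 2 * M%:R) * ln M%:R <= 1 * ln M%:R :> R by apply: ler_wpM2r => //; lra.
nra.
Qed.

Lemma chebyshev_psi_le (R : realType) N : chebyshev_psi R N <= 10 * N%:R.
Proof.
elim/ltn_ind: N => N IH.
have [->|N0] := posnP N; first by rewrite /chebyshev_psi big_geq // mulr0.
have := IH (N %/ 2)%N; rewrite ltn_Pdiv // => /(_ isT) h1.
have := chebyshev_psi_half R N; have := ln_fact_half R N.
have : (N %/ 2)%:R * 2 <= N%:R :> R by rewrite -natrM ler_nat; lia.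
by lra.
Qed.

Lemma divn_real_itv (R : realType) (N d : nat) : (0 < d)%N ->
  (N %/ d)%:R <= N%:R / d%:R :> R /\ N%:R / d%:R < (N %/ d)%:R + 1 :> R.
Proof.
move=> d0; split; rewrite ?natr1.
  by rewrite ler_pdivlMr ?ltr0n // -natrM ler_nat leq_divM.
by rewrite ltr_pdivrMr ?ltr0n // -natrM ltr_nat ltn_ceil.
Qed.

(** Replacing the floor of [N / d] by [N / d] in [ln_fact_sum_floor] costs at most
    [chebyshev_psi R N <= 10 * N]; Stirling's bounds account for the rest. *)
Lemma mertens_bound (R : realType) N : (0 < N)%N ->
  `|mertens R N - ln N%:R| <= 11.
Proof.
move=> N0; have N0R : 0 < N%:R :> R by rewrite ltr0n.
have ME : N%:R * mertens R N = \sum_(1 <= d < N.+1) von_mangoldt R d * (N%:R / d%:R).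
  by rewrite mulr_sumr; apply: eq_bigr => d _; ring.
have L : ln_fact R N <= N%:R * mertens R N.
  rewrite ME ln_fact_sum_floor !big_nat; apply: ler_sum => d /andP[d0 _].
  by apply: ler_wpM2l; [exact: von_mangoldt_ge0 | have [] := divn_real_itv R N d0].
have U : N%:R * mertens R N <= ln_fact R N + chebyshev_psi R N.
  rewrite ME ln_fact_sum_floor -big_split /= !big_nat; apply: ler_sum => d /andP[d0 _].
  rewrite -{3}(mulr1 (von_mangoldt R d)) -mulrDr; apply: ler_wpM2l; first exact: von_mangoldt_ge0.
  by have [_ /ltW] := divn_real_itv R N d0.
have T1 := ln_fact_ge R N; have T2 := ln_fact_le R N0.
have C := chebyshev_psi_le R N; have l1 := ln_nat_le R N.
have N1 : 1 <= N%:R :> R by rewrite ler1n.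
rewrite ler_norml; apply/andP; split; rewrite -(ler_pM2l N0R); nra.
Qed.

(** The sequence [a] decreases, [b] increases and stays below [a], and they differ by at most
    [1 / (N + 1)]; the constant is the supremum of [b]. *)
Lemma euler_gamma (R : realType) : exists g : R, forall N, (0 < N)%N ->
  `|harmonic R N - ln N%:R - g| <= N%:R^-1.
Proof.
pose a N : R := harmonic R N.+1 - ln N.+1%:R.
pose b N : R := harmonic R N.+1 - ln N.+2%:R.
have hS N : harmonic R N.+2 = harmonic R N.+1 + N.+2%:R^-1 by rewrite /harmonic sum1S.
have aS N : a N.+1 <= a N by rewrite /a hS; move: (ln_natS_ge R (ltn0Sn N)); move: (N.+2%:R^-1) => z; lra.
have bS N : b N <= b N.+1 by rewrite /b hS; move: (ln_natS_le R (ltn0Sn N.+1)); move: (N.+2%:R^-1) => z; lra.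
have am m k : a (m + k)%N <= a m.
  by elim: k => [|k IH]; [rewrite addn0 | rewrite addnS (le_trans (aS _))].
have bm m k : b m <= b (m + k)%N.
  by elim: k => [|k IH]; [rewrite addn0 | rewrite addnS (le_trans IH)].
have ba N : b N <= a N.
  by rewrite /a /b; have := @ler_ln_nat R N.+1 N.+2 isT (leqnSn _); lra.
have bam m n : b m <= a n.
  apply: le_trans (bm m n) _; apply: le_trans (ba _) _; rewrite addnC; exact: am.
pose S := (fun x : R => exists n, x = b n).
have Snz : classical_sets.nonempty S by exists (b 0%N), 0%N.
have Sub : classical_sets.has_ubound S by exists (a 0%N) => _ [n ->].
exists (sup S) => -[//|N] _.
have bsup : b N <= sup S by apply: sup_upper_bound; [split|exists N].
have asup : sup S <= a N by apply: ge_sup => // _ [n ->].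
move: (ln_natS_le R (ltn0Sn N)); move: (N.+1%:R^-1) => z.
rewrite -/(a N) ler_norml; move: bsup asup; rewrite /a /b => *; apply/andP; split; lra.
Qed.

Lemma sum_inv_sqrt_le (R : realType) N :
  \sum_(1 <= d < N.+1) (Num.sqrt d%:R)^-1 <= 2 * Num.sqrt N%:R :> R.
Proof.
elim: N => [|N IH]; first by rewrite big_geq // mulr_ge0 ?sqrtr_ge0.
rewrite sum1S.
set s := Num.sqrt N.+1%:R; set t := Num.sqrt N%:R in IH *.
have s0 : 0 < s :> R by rewrite sqrtr_gt0 ltr0n.
have t0 : 0 <= t :> R by rewrite sqrtr_ge0.
have s2 : s ^+ 2 = N.+1%:R :> R by rewrite sqr_sqrtr // ler0n.
have t2 : t ^+ 2 = N%:R :> R by rewrite sqr_sqrtr // ler0n.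
have e : s ^+ 2 = t ^+ 2 + 1 by rewrite s2 t2 natr1.
suff : s^-1 <= 2 * (s - t) by lra.
rewrite -(ler_pM2l s0) divff ?gt_eqF //.
suff : 0 <= (s - t) ^+ 2 by nra.
exact: sqr_ge0.
Qed.

Lemma ln_le_sqrt (R : realType) (x : R) : 1 <= x -> ln x <= 2 * Num.sqrt x.
Proof.
move=> x1; have x0 : 0 < x by lra.
have s0 : 0 < Num.sqrt x by rewrite sqrtr_gt0.
have -> : ln x = ln (Num.sqrt x) *+ 2 by rewrite -lnXn // sqr_sqrtr // ltW.
by have := ltW (ln_sublinear s0); rewrite mulr2n; lra.
Qed.

Lemma ln_sqr_le_sqrt (R : realType) (x : R) : 1 <= x -> ln x ^+ 2 <= 16 * Num.sqrt x.
Proof.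
move=> x1; have x0 : 0 < x by lra.
have s1 : 1 <= Num.sqrt x by rewrite -[X in X <= _]sqrtr1 ler_wsqrtr.
have s0 : 0 < Num.sqrt x by rewrite sqrtr_gt0.
have -> : ln x = ln (Num.sqrt x) *+ 2 by rewrite -lnXn // sqr_sqrtr // ltW.
have l := ln_le_sqrt s1; have l0 := ln_ge0 s1.
have e : Num.sqrt (Num.sqrt x) ^+ 2 = Num.sqrt x by rewrite sqr_sqrtr // ltW.
by rewrite mulr2n; nra.
Qed.

(** * Selberg's symmetry formula *)

(** This evaluates the inner sums of the inversion for [psi(y) - y + (g + 1)], with [M] the floor of
    [y]. The shift [g + 1] is the one for which the main terms collapse to [(M - y) * (ln M + g)],
    of logarithmic size. *)
Lemma floor_harmonic_defect (R : realType) (g : R) :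
  (forall N, (0 < N)%N -> `|harmonic R N - ln N%:R - g| <= N%:R^-1) ->
  forall (M : nat) (y : R), (0 < M)%N -> M%:R <= y < M%:R + 1 ->
  `|ln_fact R M - y * harmonic R M + (g + 1) * M%:R| <= (`|g| + 3) * (1 + ln y).
Proof.
move=> hg M y M0 /andP[My yM].
have M1 : 1 <= M%:R :> R by rewrite ler1n.
have y1 : 1 <= y by lra.
have lMy : ln M%:R <= ln y by rewrite ler_ln ?posrE //; lra.
have lM0 := ln_nat_ge0 R M.
have T1 := ln_fact_ge R M; have T2 := ln_fact_le R M0.
have /ler_normlP[e1 e2] := hg _ M0.
set H := harmonic R M in e1 e2 *; set T := ln_fact R M in T1 T2 *; set l := ln M%:R in lMy lM0 T1 T2 e1 e2 *.
set m := M%:R in M1 My yM T1 T2 e1 e2 *.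
have [n1 n2] : - `|g| <= g /\ g <= `|g| by move: (lexx `|g|); rewrite ler_norml => /andP[].
have yi : y * m^-1 <= 2 by rewrite ler_pdivrMr; lra.
have d1 : y * (H - l - g) <= 2 by apply: le_trans yi; apply: ler_wpM2l => //; lra.
have d2 : - 2 <= y * (H - l - g).
  suff : y * (- (H - l - g)) <= 2 by lra.
  by apply: le_trans yi; apply: ler_wpM2l => //; lra.
have -> : T - y * H + (g + 1) * m = (T - m * l + m) + (m - y) * (l + g) - y * (H - l - g) by ring.
have d3 : (y - m) * l <= 1 * l by apply: ler_wpM2r => //; lra.
have d30 : 0 <= (y - m) * l by apply: mulr_ge0 => //; lra.
have d4 : (y - m) * g <= 1 * `|g|.
  apply: le_trans (ler_wpM2r (normr_ge0 g) (_ : y - m <= 1)); last lra.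
  by apply: ler_wpM2l => //; lra.
have d5 : (y - m) * (- g) <= 1 * `|g|.
  apply: le_trans (ler_wpM2r (normr_ge0 g) (_ : y - m <= 1)); last lra.
  by apply: ler_wpM2l; lra.
have gl : 0 <= `|g| * ln y by apply: mulr_ge0 => //; lra.
apply/ler_normlP; split; nra.
Qed.

(* The Tatuzawa-Iseki identity, for [F j] standing for a function of [N / j]. *)
Lemma moebius_ln_inversion (R : realType) (F : nat -> R) (N : nat) : (0 < N)%N ->
  \sum_(1 <= d < N.+1) moebius R d * ln (N%:R / d%:R) *
     (\sum_(1 <= n < (N %/ d).+1) F (d * n)%N) =
  F 1%N * ln N%:R + \sum_(1 <= m < N.+1) von_mangoldt R m * F m.
Proof.
move=> N0.
transitivity (\sum_(1 <= d < N.+1) \sum_(1 <= n < (N %/ d).+1)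
   (moebius R d * ln (N%:R / d%:R) * F (d * n)%N)).
  by apply: eq_bigr => d _; rewrite mulr_sumr.
rewrite -(sum_divisor_sum (fun d m => moebius R d * ln (N%:R / d%:R) * F m)).
transitivity (\sum_(1 <= m < N.+1) ((m == 1)%N%:R * ln N%:R * F m + von_mangoldt R m * F m)).
  rewrite !big_nat; apply: eq_bigr => m /andP[m0 _].
  rewrite -mulrDl -divisor_sum_moebius // -[von_mangoldt R m]opprK -divisor_sum_moebius_ln //.
  rewrite /divisor_sum mulr_suml -sumrB mulr_suml big_nat_cond [RHS]big_nat_cond.
  apply: eq_bigr => d /andP[/andP[d0 _] _]; rewrite ln_div ?posrE ?ltr0n //; ring.
rewrite big_split /= big_ltn // big_nat big1; last first.
  by move=> i /andP[i1 _]; rewrite (_ : (i == 1)%N = false) ?mul0r //; lia.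
by rewrite eqxx mul1r addr0 mulrC.
Qed.

(** The inversion is applied to [F j = psi(N / j) - N / j + (g + 1)]. Its inner sums are
    [O(1 + ln (N / d))], so its left side is [O(N)]; its right side is Selberg's expression once
    Mertens replaces the sum of [von_mangoldt R m * N / m] by [N * ln N]. *)
Lemma selberg_psi (R : realType) : exists C : R, 0 <= C /\ forall N, (0 < N)%N ->
  `|chebyshev_psi R N * ln N%:R
    + \sum_(1 <= m < N.+1) von_mangoldt R m * chebyshev_psi R (N %/ m)
    - 2 * N%:R * ln N%:R| <= C * N%:R.
Proof.
have [g hg] := euler_gamma R.
pose K : R := `|g| + 3; have K0 : 0 <= K by rewrite /K; have := normr_ge0 g; lra.
exists (36 * K + 11 * `|g + 1| + 11); split; first by have := normr_ge0 (g + 1); lra.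
move=> N N0; have N0R : 0 < N%:R :> R by rewrite ltr0n.
pose F j : R := chebyshev_psi R (N %/ j) - N%:R / j%:R + (g + 1).
have inner d : (0 < d)%N -> (d < N.+1)%N ->
   `|\sum_(1 <= n < (N %/ d).+1) F (d * n)%N| <= K * (1 + ln (N%:R / d%:R)).
  move=> d0 dN; have M0 : (0 < N %/ d)%N by rewrite divn_gt0.
  have -> : \sum_(1 <= n < (N %/ d).+1) F (d * n)%N =
     ln_fact R (N %/ d) - N%:R / d%:R * harmonic R (N %/ d) + (g + 1) * (N %/ d)%:R.
    rewrite /F big_split /= big_split /= big_const_nat iter_addr_0 subn1 mulr_natr; congr (_ + _ + _).
      by rewrite ln_fact_sum_psi; apply: eq_bigr => n _; rewrite divnMA.
    rewrite sumrN /harmonic mulr_sumr; congr (- _); apply: eq_bigr => n _.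
    by rewrite natrM invfM mulrA.
  by rewrite /K; apply: (floor_harmonic_defect hg) => //; have [-> ->] := divn_real_itv R N d0.
have main : `|F 1%N * ln N%:R + \sum_(1 <= m < N.+1) von_mangoldt R m * F m| <= 36 * K * N%:R.
  rewrite -moebius_ln_inversion //; apply: le_trans (ler_norm_sum _ _ _) _.
  have sN : Num.sqrt N%:R * Num.sqrt N%:R = N%:R :> R by rewrite -expr2 sqr_sqrtr // ltW.
  (* With [y = N / d], [ln y + ln y ^+ 2] is at most [(2 + 16) * sqrt y], and the inverse square
     roots sum to at most [2 * sqrt N]. *)
  apply: (@le_trans _ _ (18 * K * Num.sqrt N%:R * \sum_(1 <= d < N.+1) (Num.sqrt d%:R)^-1)); last first.
    rewrite -{2}sN (_ : 36 * K * _ = 18 * K * Num.sqrt N%:R * (2 * Num.sqrt N%:R)); last by ring.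
    apply: ler_wpM2l; last exact: sum_inv_sqrt_le.
    by rewrite !mulr_ge0 ?sqrtr_ge0.
  rewrite mulr_sumr !big_nat; apply: ler_sum => d /andP[d0 dN].
  set y := N%:R / d%:R.
  have y1 : 1 <= y by rewrite ler_pdivlMr ?ltr0n // mul1r ler_nat.
  have l0 := ln_ge0 y1; have l1 := ln_le_sqrt y1; have l2 := ln_sqr_le_sqrt y1.
  have -> : 18 * K * Num.sqrt N%:R / Num.sqrt d%:R = K * (18 * Num.sqrt y).
    by rewrite /y sqrtrM ?ltW // sqrtrV ?ler0n //; ring.
  rewrite !normrM (ger0_norm l0).
  apply: (@le_trans _ _ (1 * ln y * (K * (1 + ln y)))).
    apply: ler_pM => //; [by rewrite mulr_ge0 | | exact: inner].
    by apply: ler_wpM2r => //; exact: norm_moebius_le1.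
  have -> : 1 * ln y * (K * (1 + ln y)) = K * (ln y + ln y ^+ 2) by ring.
  by apply: ler_wpM2l => //; lra.
set P := chebyshev_psi R N; set L := ln N%:R in main *.
set X := \sum_(1 <= m < N.+1) _ * chebyshev_psi R _.
have E : \sum_(1 <= m < N.+1) von_mangoldt R m * F m = X - N%:R * mertens R N + (g + 1) * P.
  have -> : (g + 1) * P = \sum_(1 <= m < N.+1) (g + 1) * von_mangoldt R m by rewrite /P mulr_sumr.
  rewrite /X /mertens mulr_sumr -sumrB -big_split /=; apply: eq_bigr => m _.
  by rewrite /F; ring.
have F1 : F 1%N = P - N%:R + (g + 1) by rewrite /F divn1 divr1.
rewrite E F1 in main.
have /ler_normlP[m1 m2] := mertens_bound R N0; rewrite -/L in m1 m2.
have -> : P * L + X - 2 * N%:R * L =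
  ((P - N%:R + (g + 1)) * L + (X - N%:R * mertens R N + (g + 1) * P))
   + (- (g + 1) * (L + P) + N%:R * (mertens R N - L)) by ring.
have -> : (36 * K + 11 * `|g + 1| + 11) * N%:R =
  36 * K * N%:R + (`|g + 1| * (11 * N%:R) + N%:R * 11) by ring.
apply: le_trans (ler_normD _ _) _; apply: lerD => //.
apply: le_trans (ler_normD _ _) _; apply: lerD.
  rewrite normrM normrN; apply: ler_wpM2l => //.
  have P1 : P <= 10 * N%:R := chebyshev_psi_le R N; have L1 : L <= N%:R := ln_nat_le R N.
  rewrite ger0_norm; first lra.
  by apply: addr_ge0; [exact: ln_nat_ge0 | exact: chebyshev_psi_ge0].
rewrite normrM (ger0_norm (ltW N0R)); apply: ler_wpM2l; [exact: ltW | exact: mertens_bound].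
Qed.

(** Selberg's function, the second von Mangoldt function: von Mangoldt times logarithm, plus its
    Dirichlet square. *)
Definition selberg_fn (R : realType) n : R :=
  von_mangoldt R n * ln n%:R
  + divisor_sum (fun d => von_mangoldt R d * von_mangoldt R (n %/ d)) n.

Definition selberg_log (R : realType) N : R :=
  \sum_(1 <= n < N.+1) selberg_fn R n / n%:R.

(** Partial summation: passing to [N + 1] adds [psi(N) * (ln (N + 1) - ln N)], at most
    [10 * N / N]. *)
Lemma sum_von_mangoldt_ln (R : realType) N :
  0 <= chebyshev_psi R N * ln N%:R - \sum_(1 <= n < N.+1) von_mangoldt R n * ln n%:R <= 10 * N%:R.
Proof.
elim: N => [|N IH]; first by rewrite /chebyshev_psi !big_geq // mul0r subrr mulr0 lexx.
rewrite sum1S /chebyshev_psi sum1S -/(chebyshev_psi R N).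
have [->|N0] := posnP N.
  by rewrite /chebyshev_psi !big_geq // ln1; apply/andP; split; lra.
have d1 := ln_natS_le R N0.
have d0 : 0 <= ln N.+1%:R - ln N%:R :> R by rewrite subr_ge0; apply: ler_ln_nat.
have : 0 <= chebyshev_psi R N * (ln N.+1%:R - ln N%:R) <= 10.
  rewrite mulr_ge0 ?chebyshev_psi_ge0 //=.
  apply: le_trans (_ : 10 * N%:R * N%:R^-1 <= _); last by rewrite mulfK // pnatr_eq0 -lt0n.
  by apply: ler_pM => //; [exact: chebyshev_psi_ge0 | exact: chebyshev_psi_le].
set S := \sum_(1 <= n < N.+1) _ in IH *; set P := chebyshev_psi R N in IH *.
rewrite (_ : (P + _) * _ - _ = (P * ln N%:R - S) + P * (ln N.+1%:R - ln N%:R)); last by ring.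
by rewrite -[X in 10 * X]natr1; move: IH => /andP[? ?] /andP[? ?]; apply/andP; split; lra.
Qed.

Lemma selberg_sum (R : realType) : exists C : R, 0 <= C /\ forall N, (0 < N)%N ->
  `|\sum_(1 <= n < N.+1) selberg_fn R n - 2 * N%:R * ln N%:R| <= C * N%:R.
Proof.
have [C [C0 hC]] := selberg_psi R; exists (C + 10); split; first lra.
move=> N N0; have := hC N N0.
rewrite /selberg_fn big_split /=.
rewrite (sum_divisor_sum (fun d n => von_mangoldt R d * von_mangoldt R (n %/ d))).
have -> : \sum_(1 <= m < N.+1) von_mangoldt R m * chebyshev_psi R (N %/ m) =
   \sum_(1 <= d < N.+1) \sum_(1 <= k < (N %/ d).+1)
       von_mangoldt R d * von_mangoldt R (d * k %/ d).
  rewrite !big_nat; apply: eq_bigr => d /andP[d0 _].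
  by rewrite mulr_sumr; apply: eq_bigr => k _; rewrite mulKn.
have /andP[h1 h2] := sum_von_mangoldt_ln R N.
by move=> /ler_normlP[? ?]; apply/ler_normlP; split; lra.
Qed.

(** Partial summation. Once the bounded term [r N / N] is removed, the error [E] moves by
    [O(ln (N + 1) - ln N)] per step, so telescoping leaves a bound in terms of [ln N - ln M] alone,
    as windows of bounded logarithmic length require. *)
Lemma selberg_log_diff (R : realType) : exists C : R, 0 <= C /\ forall M N, (0 < M <= N)%N ->
  `|selberg_log R N - selberg_log R M - (ln N%:R ^+ 2 - ln M%:R ^+ 2)|
     <= C * (1 + (ln N%:R - ln M%:R)).
Proof.
have [C [C0 hC]] := selberg_sum R.
pose r N : R := \sum_(1 <= n < N.+1) selberg_fn R n - 2 * N%:R * ln N%:R.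
pose E N : R := selberg_log R N - r N / N%:R - ln N%:R ^+ 2.
have rN N : (0 < N)%N -> `|r N / N%:R| <= C.
  move=> N0; have N0R : 0 < N%:R :> R by rewrite ltr0n.
  by rewrite normrM normfV (ger0_norm (ltW N0R)) ler_pdivrMr //; apply: hC.
have step N : (0 < N)%N -> `|E N.+1 - E N| <= (C + 4) * (ln N.+1%:R - ln N%:R).
  move=> N0; have N0R : 0 < N%:R :> R by rewrite ltr0n.
  have S0R : 0 < N.+1%:R :> R by rewrite ltr0n.
  have rE : selberg_fn R N.+1 = r N.+1 - r N + 2 * N.+1%:R * ln N.+1%:R - 2 * N%:R * ln N%:R.
    by rewrite /r sum1S; ring.
  have EE : E N.+1 - E N = r N / N%:R / N.+1%:R + 2 * N%:R * (ln N.+1%:R - ln N%:R) / N.+1%:R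
      + 2 * ln N.+1%:R / N.+1%:R - (ln N.+1%:R ^+ 2 - ln N%:R ^+ 2).
    rewrite /E {1}/selberg_log sum1S -/(selberg_log R N) rE -!natr1.
    by field; rewrite natr1 !pnatr_eq0; lia.
  have d1 := ln_natS_le R N0; have d2 := ln_natS_ge R N0.
  have l1 : ln N.+1%:R <= N%:R :> R.
    by rewrite -natr1 addrC; apply: le_ln1Dx; lra.
  have l0 := ln_nat_ge0 R N; have rb := rN N N0.
  have i0 : 0 < N.+1%:R^-1 :> R by rewrite invr_gt0.
  have i1 : N.+1%:R * N.+1%:R^-1 = 1 :> R by rewrite divff ?gt_eqF.
  have i2 : N%:R * N%:R^-1 = 1 :> R by rewrite divff ?gt_eqF.
  have NS : N.+1%:R = N%:R + 1 :> R by rewrite natr1.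
  have N1R : 1 <= N%:R :> R by rewrite ler1n.
  rewrite EE; move: N1R rb d1 d2 l1 l0 i0 i1 i2 NS S0R N0R.
  move: (N%:R) (N.+1%:R) (ln N%:R) (ln N.+1%:R) (r N / N%:R) => n s a b q.
  move: (s^-1) (n^-1) => si ni N1R /ler_normlP[q1 q2] d1 d2 l1 l0 i0 i1 i2 NS s0 n0.
  have a1 : q * si <= C * (b - a).
    by apply: le_trans (ler_wpM2l C0 d2); apply: ler_wpM2r; lra.
  have a2 : - q * si <= C * (b - a).
    by apply: le_trans (ler_wpM2l C0 d2); apply: ler_wpM2r; lra.
  have a3 : n * si = 1 - si by rewrite -i1 NS; ring.
  have a4 : si <= ni by lra.
  have a5 : b * si <= b * (b - a) by apply: ler_wpM2l; lra.
  have a6 : b * (b - a) <= b * ni by apply: ler_wpM2l; lra.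
  have a7 : ni - si = ni * si.
    have -> : ni - si = (ni * si) * (s - n) + ni * (1 - s * si) - si * (1 - n * ni) by ring.
    by rewrite i1 i2 NS; ring.
  have n1 : 0 < ni by lra.
  have a8 : b * (ni - si) <= si.
    rewrite a7 mulrA -[X in _ <= X]mul1r; apply: ler_wpM2r; first exact: ltW.
    by rewrite -i2; apply: ler_wpM2r => //; exact: ltW.
  have a9 : (b - a) * (b - a) <= 2 * si.
    have : (b - a) * (b - a) <= ni * ni by apply: ler_pM; lra.
    have m1 : ni * ni <= ni * 1.
      apply: ler_wpM2l; first exact: ltW.
      have : 0 <= (n - 1) * ni by apply: mulr_ge0; lra.
      by rewrite mulrBl i2; lra.
    have m2 : 0 <= (2 * n - s) * (si * ni) by rewrite !mulr_ge0 //; lra.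
    have m3 : (2 * n - s) * (si * ni) = 2 * (n * ni) * si - (s * si) * ni by ring.
    rewrite m3 i1 i2 in m2.
    lra.
  have -> : 2 * n * (b - a) * si = 2 * (b - a) - 2 * (si * (b - a)).
    by rewrite (_ : 2 * n * (b - a) * si = 2 * (n * si) * (b - a)); [rewrite a3|]; ring.
  have b1 : 0 <= si * (b - a) by apply: mulr_ge0; lra.
  have b3 : 0 <= (b - a) * (b - a) by apply: mulr_ge0; lra.
  have b4 : 0 <= n * si * (b - a) by rewrite !mulr_ge0 //; lra.
  rewrite a3 in b4.
  have b2 : b ^+ 2 - a ^+ 2 = 2 * (b * (b - a)) - (b - a) * (b - a) by ring.
  rewrite b2 -(mulrA 2 b si).
  apply/ler_normlP; split; lra.
have tele M k : (0 < M)%N -> `|E (M + k)%N - E M| <= (C + 4) * (ln (M + k)%:R - ln M%:R).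
  move=> M0; elim: k => [|k IH]; first by rewrite addn0 !subrr normr0 mulr0.
  have := step (M + k)%N; rewrite addn_gt0 M0 => /(_ isT) h; rewrite addnS.
  have -> : E (M + k).+1 - E M = (E (M + k).+1 - E (M + k)%N) + (E (M + k)%N - E M) by ring.
  by apply: le_trans (ler_normD _ _) _; lra.
exists (3 * C + 4); split; first lra.
move=> M N /andP[M0 MN]; have N0 : (0 < N)%N by lia.
have := tele M (N - M)%N M0; rewrite subnKC // => h.
have l : 0 <= ln N%:R - ln M%:R :> R by rewrite subr_ge0; apply: ler_ln_nat.
move: h (rN _ N0) (rN _ M0); rewrite /E; set x := r N / _; set z := r M / _.
move=> /ler_normlP[? ?] /ler_normlP[? ?] /ler_normlP[? ?]; have := mulr_ge0 C0 l.
by move=> ?; apply/ler_normlP; split; nra.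
Qed.

(** * Selberg's formula on the logarithmic scale *)

Definition efloor (R : realType) (u : R) : nat := Num.truncn (expR u).

Lemma leq_efloor (R : realType) (n : nat) (u : R) : (0 < n)%N ->
  (n <= efloor u)%N = (ln n%:R <= u).
Proof.
move=> n0; rewrite /efloor truncn_ge_nat ?expR_ge0 //.
by rewrite -[in RHS](expRK u) ler_ln ?posrE ?ltr0n ?expR_gt0.
Qed.

Lemma ltn_efloor (R : realType) (n : nat) (u : R) : (0 < n)%N ->
  (efloor u < n)%N = (u < ln n%:R).
Proof. by move=> n0; rewrite ltnNge leq_efloor // ltNge. Qed.

Lemma efloor_mono (R : realType) (u v : R) : u <= v -> (efloor u <= efloor v)%N.
Proof. by move=> uv; apply: le_truncn; rewrite ler_expR. Qed.

Lemma efloor_gt0 (R : realType) (u : R) : (0 < efloor u)%N = (0 <= u).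
Proof. by rewrite (leq_efloor u (ltn0Sn 0)) ln1. Qed.

(** Nested floors collapse; this turns Mertens sums up to [N / n] into masses at the translated
    point [u - ln n]. *)
Lemma efloor_sub_ln (R : realType) (n : nat) (u : R) : (0 < n)%N ->
  efloor (u - ln n%:R) = (efloor u %/ n)%N.
Proof.
move=> n0.
have h k : (0 < k)%N -> (k <= efloor (u - ln n%:R))%N = (k <= efloor u %/ n)%N.
  move=> k0; rewrite leq_efloor // leq_divRL // leq_efloor ?muln_gt0 ?k0 //.
  by rewrite natrM lnM ?posrE ?ltr0n // lerBrDr.
apply/eqP; rewrite eqn_leq; apply/andP; split.
  by case: (posnP (efloor (u - ln n%:R))) => [->//|p]; rewrite -h.
by case: (posnP (efloor u %/ n)) => [->//|p]; rewrite h.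
Qed.

Lemma ln_efloor (R : realType) (u : R) : 0 <= u ->
  ln (efloor u)%:R <= u /\ u <= ln (efloor u)%:R + (efloor u)%:R^-1.
Proof.
move=> u0; have M0 : (0 < efloor u)%N by rewrite efloor_gt0.
split; first by rewrite -leq_efloor.
have : u < ln (efloor u).+1%:R by rewrite -ltn_efloor.
by have := ln_natS_le R M0; lra.
Qed.

(** Distribution function of the measure with an atom of weight [von_mangoldt R n / n] at [ln n] for
    each [n] in [P]. *)
Definition log_mass (R : realType) (P : pred nat) (u : R) : R :=
  \sum_(1 <= n < (efloor u).+1 | P n) von_mangoldt R n / n%:R.

Lemma weight_ge0 (R : realType) n : 0 <= von_mangoldt R n / n%:R.
Proof. by rewrite mulr_ge0 ?von_mangoldt_ge0 ?invr_ge0 ?ler0n. Qed.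

Lemma log_mass_diff (R : realType) (P : pred nat) (u v : R) : u <= v ->
  log_mass P v - log_mass P u =
  \sum_((efloor u).+1 <= n < (efloor v).+1 | P n) von_mangoldt R n / n%:R.
Proof.
move=> uv; rewrite /log_mass (@big_cat_nat _ _ _ (efloor u).+1 1 (efloor v).+1) //=.
  by rewrite addrAC subrr add0r.
by rewrite ltnS efloor_mono.
Qed.

Lemma log_mass_mono (R : realType) (P : pred nat) (u v : R) : u <= v ->
  log_mass P u <= log_mass P v.
Proof.
move=> uv; rewrite -subr_ge0 log_mass_diff //.
by apply: sumr_ge0 => n _; exact: weight_ge0.
Qed.

Lemma log_mass_ge0 (R : realType) (P : pred nat) (u : R) : 0 <= log_mass P u.
Proof. by apply: sumr_ge0 => n _; exact: weight_ge0. Qed.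

Lemma log_massE (R : realType) (u : R) : log_mass predT u = mertens R (efloor u).
Proof. by []. Qed.

Lemma log_mass_lt0 (R : realType) (u : R) : u < 0 -> log_mass predT u = 0.
Proof.
move=> u0; rewrite /log_mass big_geq // ltnS leqn0.
by move: u0; rewrite ltNge -efloor_gt0 -eqn0Ngt.
Qed.

(** The bound is 11 from Mertens plus 1 for rounding [u] down to [ln (efloor u)]. *)
Lemma log_mass_bound (R : realType) (u : R) : 0 <= u -> `|log_mass predT u - u| <= 12.
Proof.
move=> u0; have M0 : (0 < efloor u)%N by rewrite efloor_gt0.
have /ler_normlP[? ?] := mertens_bound R M0; have [? ?] := ln_efloor u0.
have : (efloor u)%:R^-1 <= 1 :> R by rewrite invf_le1 ?ltr0n // ler1n.
by rewrite log_massE => ?; apply/ler_normlP; split; lra.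
Qed.

Lemma log_mass_diff_le (R : realType) (u h : R) : 0 <= h ->
  log_mass predT (u + h) - log_mass predT u <= h + 24.
Proof.
move=> h0; have [u0|u0] := leP 0 u.
  have /ler_normlP[? ?] := log_mass_bound u0.
  have /ler_normlP[? ?] : `|log_mass predT (u + h) - (u + h)| <= 12.
    by apply: log_mass_bound; lra.
  by lra.
rewrite (log_mass_lt0 u0); have [v0|v0] := leP 0 (u + h).
  by have /ler_normlP[? ?] := log_mass_bound v0; lra.
by rewrite (log_mass_lt0 v0); lra.
Qed.

(** For [m = efloor x] and [l = ln m], [x - l <= 1 / m] and [x + l <= 2 * l + 1] with [l <= m], so
    rounding changes the square by at most 3. *)
Lemma selberg_log_real (R : realType) : exists C : R, 0 <= C /\ forall u v : R, 0 <= u <= v ->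
  `|selberg_log R (efloor v) - selberg_log R (efloor u) - (v ^+ 2 - u ^+ 2)| <= C * (1 + (v - u)).
Proof.
have [C [C0 hC]] := selberg_log_diff R; exists (2 * C + 6); split; first lra.
move=> u v /andP[u0 uv].
have sq (x : R) : 0 <= x -> 0 <= x ^+ 2 - ln (efloor x)%:R ^+ 2 <= 3 /\
                      0 <= x - ln (efloor x)%:R <= 1.
  move=> x0; have M0 : (0 < efloor x)%N by rewrite efloor_gt0.
  have [a1 a2] := ln_efloor x0; have l0 := ln_nat_ge0 R (efloor x).
  have l1 := ln_nat_le R (efloor x).
  have M1 : 1 <= (efloor x)%:R :> R by rewrite ler1n.
  move: a1 a2 l0 l1 M1; move: ((efloor x)%:R) (ln _) => m l a1 a2 l0 l1 m1.
  have m0 : 0 < m by lra.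
  have i1 : m * m^-1 = 1 by rewrite divff // gt_eqF.
  have i0 : 0 <= m^-1 by rewrite invr_ge0; lra.
  have i2 : m^-1 <= 1 by rewrite invf_le1; lra.
  move: (m^-1) i1 i0 i2 a2 => i i1 i0 i2 a2.
  have b1 : l * i <= m * i by apply: ler_wpM2r.
  have b2 : (x - l) * (x + l) <= i * (2 * l + 1).
    by apply: ler_pM; lra.
  have b3 : 0 <= (x - l) * (x + l) by apply: mulr_ge0; lra.
  have e : x ^+ 2 - l ^+ 2 = (x - l) * (x + l) by ring.
  by rewrite e; split; apply/andP; split; lra.
have [/andP[? ?] /andP[? ?]] := sq u u0.
have [/andP[? ?] /andP[? ?]] := sq v (le_trans u0 uv).
have : (0 < efloor u <= efloor v)%N by rewrite efloor_gt0 u0 efloor_mono.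
move=> /hC /ler_normlP[].
set X := selberg_log R _; set Y := selberg_log R _.
move=> x1 x2.
have y : C * (1 + (ln (efloor v)%:R - ln (efloor u)%:R)) <= C * (2 + (v - u)) by apply: ler_wpM2l => //; lra.
have z : 0 <= C * (v - u) by apply: mulr_ge0; lra.
by apply/ler_normlP; split; lra.
Qed.

Lemma selberg_log_split (R : realType) N :
  selberg_log R N = \sum_(1 <= n < N.+1) von_mangoldt R n / n%:R * ln n%:R
   + \sum_(1 <= n < N.+1) von_mangoldt R n / n%:R * mertens R (N %/ n).
Proof.
rewrite /selberg_log /selberg_fn.
transitivity (\sum_(1 <= n < N.+1) (von_mangoldt R n / n%:R * ln n%:R +
  divisor_sum (fun d => von_mangoldt R d * von_mangoldt R (n %/ d) / n%:R) n)).
  by apply: eq_bigr => n _; rewrite mulrDl /divisor_sum mulr_suml mulrAC.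
rewrite big_split /=; congr (_ + _).
rewrite (sum_divisor_sum (fun d n => von_mangoldt R d * von_mangoldt R (n %/ d) / n%:R)).
rewrite !big_nat; apply: eq_bigr => d /andP[d0 _]; rewrite mulr_sumr; apply: eq_bigr => k _.
by rewrite mulKn // natrM invfM; ring.
Qed.

(** The second sum is the mass that the self-convolution of the measure gives to [(u, v]]. Both of
    its halves may run up to [efloor v], since [efloor u / n = 0] for the additional [n]. *)
Lemma selberg_log_increment (R : realType) (u v : R) : u <= v ->
  selberg_log R (efloor v) - selberg_log R (efloor u) =
  \sum_((efloor u).+1 <= n < (efloor v).+1) von_mangoldt R n / n%:R * ln n%:R
  + \sum_(1 <= n < (efloor v).+1) von_mangoldt R n / n%:R *
      (log_mass predT (v - ln n%:R) - log_mass predT (u - ln n%:R)).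
Proof.
move=> uv; set M := efloor u; set N := efloor v.
have MN : (M <= N)%N := efloor_mono uv.
rewrite !selberg_log_split (@big_cat_nat _ _ _ M.+1 1 N.+1) //=.
have -> : \sum_(1 <= n < M.+1) von_mangoldt R n / n%:R * mertens R (M %/ n) =
          \sum_(1 <= n < N.+1) von_mangoldt R n / n%:R * mertens R (M %/ n).
  rewrite [RHS](@big_cat_nat _ _ _ M.+1) //= [X in _ + X]big_nat [X in _ + X]big1 ?addr0 //.
  by move=> n /andP[Mn _]; rewrite divn_small // /mertens big_geq // mulr0.
have -> : \sum_(1 <= n < N.+1) von_mangoldt R n / n%:R *
      (log_mass predT (v - ln n%:R) - log_mass predT (u - ln n%:R)) =
    \sum_(1 <= n < N.+1) von_mangoldt R n / n%:R * mertens R (N %/ n)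
    - \sum_(1 <= n < N.+1) von_mangoldt R n / n%:R * mertens R (M %/ n).
  rewrite -sumrB !big_nat; apply: eq_bigr => n /andP[n0 _].
  by rewrite !log_massE !efloor_sub_ln // mulrBr.
ring.
Qed.

(** The convolution is nonnegative and is dropped, and [ln n > u] on the window; hence no far window
    has density much above 2. *)
Lemma selberg_upper (R : realType) : exists C : R, 0 <= C /\ forall u h : R, 0 <= u -> 0 <= h ->
  u * (log_mass predT (u + h) - log_mass predT u) <= 2 * h * u + h ^+ 2 + C * (1 + h).
Proof.
have [C [C0 hC]] := selberg_log_real R; exists C; split=> // u h u0 h0.
have uv : u <= u + h by lra.
have := hC u (u + h); rewrite u0 uv => /(_ isT) /ler_normlP[_].
rewrite selberg_log_increment // (_ : u + h - u = h); last ring.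
set S1 := \sum_(_ <= _ < _) _; set S2 := \sum_(_ <= _ < _) _ => x.
have S20 : 0 <= S2.
  apply: sumr_ge0 => n _; apply: mulr_ge0; first exact: weight_ge0.
  by rewrite subr_ge0 log_mass_mono //; lra.
have S1u : u * (log_mass predT (u + h) - log_mass predT u) <= S1.
  rewrite log_mass_diff // mulr_sumr /S1 !big_nat; apply: ler_sum => n /andP[un _].
  rewrite mulrC; apply: ler_wpM2l; first exact: weight_ge0.
  by apply: ltW; rewrite -ltn_efloor //; lia.
nra.
Qed.

Lemma selberg_lower (R : realType) : exists C : R, 0 <= C /\ forall u h : R, 0 <= u -> 0 <= h ->
  2 * h * u <= (u + h) * (log_mass predT (u + h) - log_mass predT u)
    + \sum_(1 <= n < (efloor (u + h)).+1) von_mangoldt R n / n%:R *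
      (log_mass predT (u + h - ln n%:R) - log_mass predT (u - ln n%:R)) + C * (1 + h).
Proof.
have [C [C0 hC]] := selberg_log_real R; exists C; split=> // u h u0 h0.
have uv : u <= u + h by lra.
have := hC u (u + h); rewrite u0 uv => /(_ isT) /ler_normlP[+ _].
rewrite selberg_log_increment // (_ : u + h - u = h); last ring.
set S1 := \sum_(_.+1 <= _ < _) _; set S2 := \sum_(1 <= _ < _) _ => x.
have S1u : S1 <= (u + h) * (log_mass predT (u + h) - log_mass predT u).
  rewrite log_mass_diff // mulr_sumr /S1 !big_nat; apply: ler_sum => n /andP[un nv].
  rewrite mulrC; apply: ler_wpM2r; first exact: weight_ge0.
  by rewrite -leq_efloor //; lia.
nra.
Qed.

(** * Erdős's argument *)

Definition log_dense (R : realType) (h : R) : Prop :=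
  exists2 d : R, 0 < d & exists U : R, forall u, U <= u ->
    d <= log_mass predT (u + h) - log_mass predT u.

(** If [(u, u + h]] is almost empty, the convolution must supply nearly [2 * h * u]. The translated
    windows carry at most [2 * h + e'] each and the weights total about [u], so the [n] whose
    windows fall short by [e] have small total weight. *)
Lemma log_dense_bad_mass (R : realType) (C h eps e e' T u : R) (bad : pred nat) :
  0 <= C -> 0 < h -> 0 <= eps -> 0 < e -> 0 <= e' -> 0 < T -> T <= u ->
  2 * h * u <= (u + h) * (log_mass predT (u + h) - log_mass predT u)
    + \sum_(1 <= n < (efloor (u + h)).+1) von_mangoldt R n / n%:R *
      (log_mass predT (u + h - ln n%:R) - log_mass predT (u - ln n%:R)) + C * (1 + h) ->
  log_mass predT (u + h) - log_mass predT u <= eps ->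
  (forall x : R, T <= x -> log_mass predT (x + h) - log_mass predT x <= 2 * h + e') ->
  (forall n, bad n ->
     log_mass predT (u - ln n%:R + h) - log_mass predT (u - ln n%:R) <= 2 * h - e) ->
  e * log_mass bad (u - T) <= (e' + eps) * u + 12 * (2 * h + e')
     + (T + h + 24) * (h + 24) + h * eps + C * (1 + h).
Proof.
move=> C0 h0 eps0 e0 e'0 T0 Tu low gap upper badP.
set D := fun n => log_mass predT (u + h - ln n%:R) - log_mass predT (u - ln n%:R).
have DE n : D n = log_mass predT (u - ln n%:R + h) - log_mass predT (u - ln n%:R).
  by rewrite /D (_ : u + h - ln n%:R = u - ln n%:R + h) //; ring.
set w := fun n => von_mangoldt R n / n%:R.
have w0 n : 0 <= w n := weight_ge0 R n.
have uT : u - T <= u + h by lra.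
have split_sum : \sum_(1 <= n < (efloor (u + h)).+1) w n * D n =
  \sum_(1 <= n < (efloor (u - T)).+1) w n * D n
  + \sum_((efloor (u - T)).+1 <= n < (efloor (u + h)).+1) w n * D n.
  by rewrite (@big_cat_nat _ _ _ (efloor (u - T)).+1) //= ltnS efloor_mono.
have far : \sum_((efloor (u - T)).+1 <= n < (efloor (u + h)).+1) w n * D n <=
    (T + h + 24) * (h + 24).
  apply: (@le_trans _ _ ((log_mass predT (u + h) - log_mass predT (u - T)) * (h + 24))).
    rewrite log_mass_diff // mulr_suml; apply: ler_sum => n _.
    by apply: ler_wpM2l => //; rewrite DE; apply: log_mass_diff_le; lra.
  apply: ler_wpM2r; first lra.
  have := @log_mass_diff_le R (u - T) (T + h); rewrite (_ : u - T + (T + h) = u + h); last ring.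
  by move=> H; apply: le_trans (H _) _; lra.
have near : \sum_(1 <= n < (efloor (u - T)).+1) w n * D n <=
    (2 * h + e') * log_mass predT (u - T) - e * log_mass bad (u - T).
  rewrite /log_mass !mulr_sumr [X in _ <= _ - X]big_mkcond -sumrB /= !big_nat.
  apply: ler_sum => n /andP[n0 nT].
  have nu : T <= u - ln n%:R by have : ln n%:R <= u - T by [rewrite -leq_efloor]; lra.
  rewrite -/(w n); case: ifP => bn.
    have := badP n bn; rewrite -DE => h1.
    rewrite -mulrBl mulrC; apply: ler_wpM2r => //; lra.
  by rewrite subr0 mulrC; apply: ler_wpM2r => //; rewrite DE; exact: upper.
have /ler_normlP[_ m1] : `|log_mass predT (u - T) - (u - T)| <= 12 by apply: log_mass_bound; lra.
have m2 : (2 * h + e') * log_mass predT (u - T) <= (2 * h + e') * (u + 12).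
  by apply: ler_wpM2l; lra.
have m3 : (u + h) * (log_mass predT (u + h) - log_mass predT u) <= (u + h) * eps.
  by apply: ler_wpM2l => //; lra.
move: low; rewrite -/w; rewrite split_sum => low.
lra.
Qed.

Lemma pigeonhole_block (R : realType) (f : R -> R) (a L d : R) (J : nat) :
  (forall x : R, 0 <= f x) -> f (a + J%:R * L) < J%:R * d ->
  exists2 j, (j < J)%N & f (a + j%:R * L + L) - f (a + j%:R * L) < d.
Proof.
move=> f0; elim: J => [|J IH]; first by rewrite !mul0r ltNge f0.
move=> lt; have [g|g] := ltP (f (a + J%:R * L + L) - f (a + J%:R * L)) d; first by exists J.
have aE : a + J.+1%:R * L = a + J%:R * L + L by rewrite -natr1; ring.
have [|j jJ hj] := IH; last by exists j => //; lia.
by move: lt; rewrite aE -natr1; lra.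
Qed.

(** Each link goes from [t] to some [ln n] with [n] good, a distance between [s] and [H + s], and
    the mass of [(u - ln n, u - t]] is at least [14 / 13] of its length. These intervals are
    adjacent, so the gains telescope. *)
Lemma good_chain (R : realType) (u w H s : R) (k : nat) (good : pred nat) :
  0 < H -> 0 < s ->
  (forall t : R, w <= t -> t <= w + k%:R * (H + s) ->
     exists2 n, good n & t < ln n%:R <= t + H) ->
  (forall n (r : R), good n -> w <= ln n%:R -> ln n%:R <= w + k%:R * (H + s) -> s <= r <= H + s ->
     14 / 13 * r <= log_mass predT (u - ln n%:R + r) - log_mass predT (u - ln n%:R)) ->
  exists t : R, [/\ w + k%:R * s <= t, t <= w + k%:R * (H + s) &
    14 / 13 * (t - w) <= log_mass predT (u - w) - log_mass predT (u - t)].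
Proof.
move=> H0 s0 ex gain.
suff h i : (i <= k)%N -> exists t : R, [/\ w + i%:R * s <= t, t <= w + i%:R * (H + s) &
    14 / 13 * (t - w) <= log_mass predT (u - w) - log_mass predT (u - t)] by exact: h.
elim: i => [|i IH] ik.
  by exists w; rewrite !mul0r addr0 !subrr mulr0 lexx.
have [t [t1 t2 t3]] := IH (ltnW ik).
have iS : i.+1%:R = i%:R + 1 :> R by rewrite natr1.
have ikR : i%:R + 1 <= k%:R :> R by rewrite natr1 ler_nat.
have i0 : 0 <= i%:R :> R by rewrite ler0n.
have ik2 : (i%:R + 1) * (H + s) <= k%:R * (H + s) by apply: ler_wpM2r => //; lra.
have is0 : 0 <= i%:R * s by apply: mulr_ge0; lra.
(* Searching from [t + s] rather than from [t] forces progress by at least [s]. *)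
have [||n gn /andP[n1 n2]] := ex (t + s); [lra| lra |].
have := gain n (ln n%:R - t) gn; rewrite (_ : u - ln n%:R + (ln n%:R - t) = u - t); last ring.
move=> gn'; exists (ln n%:R); rewrite iS; split; [lra | lra |].
have : 14 / 13 * (ln n%:R - t) <= log_mass predT (u - t) - log_mass predT (u - ln n%:R).
  by apply: gn'; [lra | lra | apply/andP; split; lra].
lra.
Qed.

(* [2 * min(r, h) >= 16 / 13 * r] as [r <= H + s], and the two errors cost at most [2 / 13 * s]. *)
Lemma density_gain (R : realType) (H x r e' : R) (s := H / 12) (e := s / 13) (h := 2 / 3 * H) :
  0 < H ->
  (forall q : R, 0 <= q <= h ->
     log_mass predT (x + h) - log_mass predT (x + q) <= 2 * (h - q) + e') ->
  2 * h - e < log_mass predT (x + h) - log_mass predT x -> e' <= e ->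
  s <= r <= H + s ->
  14 / 13 * r <= log_mass predT (x + r) - log_mass predT x.
Proof.
rewrite /e /h /s => H0 up good e'e /andP[r1 r2]; have [rh|hr] := leP r (2 / 3 * H).
  by have := up r; rewrite rh andbT => /(_ ltac:(lra)); lra.
have : log_mass predT (x + 2 / 3 * H) <= log_mass predT (x + r) by apply: log_mass_mono; lra.
lra.
Qed.

(** By contradiction: a nearly empty window of length [2 / 3 * H] makes bad [n] rare, so some block
    of length [L] has bad mass below [d]. Every window of length [H] in that block carries mass at
    least [d], hence contains a good [n], and the resulting chain violates the Mertens bound. *)
Lemma log_dense_step (R : realType) (H : R) :
  0 < H -> log_dense H -> log_dense (2 / 3 * H).
Proof.
move=> H0 [d d0 [U0 dU0]].
have [U [U_ge0 dU]] : exists U : R, 0 <= U /\ forall u, U <= u ->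
    d <= log_mass predT (u + H) - log_mass predT u.
  exists (Num.max 0 U0); rewrite le_max lexx; split=> // u; rewrite ge_max => /andP[_]; exact: dU0.
set h := 2 / 3 * H; have h0 : 0 < h by rewrite /h; lra.
pose s := H / 12; have s0 : 0 < s by rewrite /s; lra.
have [C1 [C10 up]] := selberg_upper R; have [C2 [C20 low]] := selberg_lower R.
(* [312 = 13 * 24]: over a length above 312 the excess density [1 / 13] beats the slack 24 of
   [log_mass_diff_le]. *)
pose k := (Num.truncn (312 / s)).+1.
have ks : 312 < k%:R * s by rewrite -ltr_pdivrMr //; exact: truncnS_gt.
pose L := k%:R * (H + s) + H.
have L0 : 0 < L by rewrite /L; have : 0 <= k%:R * (H + s) by [rewrite mulr_ge0 ?ler0n //; lra]; lra.
pose e := s / 13; have e0 : 0 < e by rewrite /e; lra.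
(* The available blocks cover more than [u / 4], so bad mass at least [d] in each of them would
   exceed [kappa * u]. *)
pose kappa := d / (4 * L).
have kappa0 : 0 < kappa by rewrite /kappa divr_gt0 //; lra.
pose eps := e * kappa / 4; have eps0 : 0 < eps by rewrite /eps; have := mulr_gt0 e0 kappa0; lra.
pose e' := Num.min e eps.
have e'0 : 0 < e' by rewrite lt_min e0.
have e'e : e' <= e by rewrite ge_min lexx.
have e'eps : e' <= eps by rewrite ge_min lexx orbT.
pose X := h ^+ 2 + C1 * (1 + h).
have X0 : 0 < X.
  have := mulr_ge0 C10 (_ : 0 <= 1 + h); have := exprn_gt0 2 h0; rewrite /X => ? H'.
  by have := H' ltac:(lra); lra.
(* [X] bounds the error of [selberg_upper] for lengths up to [h]; dividing by a point beyond [T]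
   makes it at most [e']. *)
pose T := X / e'; have T0 : 0 < T by rewrite divr_gt0.
have TX : T * e' = X by rewrite /T divfK // gt_eqF.
have upT (x r : R) : T <= x -> 0 <= r <= h ->
    log_mass predT (x + r) - log_mass predT x <= 2 * r + e'.
  move=> Tx /andP[r0 rh]; have x0 : 0 < x by lra.
  have := up x r (ltW x0) r0.
  have q1 : r ^+ 2 <= h ^+ 2 by rewrite ler_sqr ?nnegrE //; lra.
  have q2 : C1 * (1 + r) <= C1 * (1 + h) by apply: ler_wpM2l => //; lra.
  have q3 : T * e' <= x * e' by apply: ler_wpM2r => //; lra.
  rewrite TX /X in q3 => q4.
  rewrite -(ler_pM2l x0); lra.
pose K := 12 * (2 * h + e') + (T + h + 24) * (h + 24) + h * eps + C2 * (1 + h).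
pose Uh := 2 * K / (e * kappa) + T + 2 * (T + U + L) + 1.
have K0 : 0 <= K.
  have k1 : 0 <= (T + h + 24) * (h + 24) by apply: mulr_ge0; lra.
  have k2 : 0 <= h * eps by apply: mulr_ge0; lra.
  have k3 : 0 <= C2 * (1 + h) by apply: mulr_ge0 => //; lra.
  by rewrite /K; lra.
have ek0 : 0 < e * kappa by apply: mulr_gt0.
have K2 : 0 <= 2 * K / (e * kappa) by rewrite divr_ge0 //; lra.
exists eps => //; exists Uh => u Uu; rewrite leNgt; apply/negP => gap.
have Tu : T <= u by rewrite /Uh in Uu; lra.
have u0 : 0 < u by lra.
have Ku : 2 * K <= e * kappa * u.
  have : 2 * K / (e * kappa) <= u by rewrite /Uh in Uu; lra.
  by rewrite ler_pdivrMr // [u * _]mulrC.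
pose bad n := log_mass predT (u - ln n%:R + h) - log_mass predT (u - ln n%:R) <= 2 * h - e.
have bm : log_mass bad (u - T) <= kappa * u.
  have := @log_dense_bad_mass R C2 h eps e e' T u bad C20 h0 (ltW eps0) e0 (ltW e'0) T0 Tu
     (low u h (ltW u0) (ltW h0)) (ltW gap).
  move=> /(_ _ _) H1; rewrite -(ler_pM2l e0); apply: le_trans (H1 _ _) _ => //.
    by move=> x Tx; apply: upT => //; rewrite ltW //= lexx.
  have : e' * u <= eps * u by apply: ler_wpM2r => //; exact: ltW.
  have epsE : eps * u = e * kappa * u / 4 by rewrite /eps; ring.
  rewrite /K in Ku; clear -Ku epsE; lra.
pose J := Num.truncn ((u - T - U) / L).
have J1 : J%:R * L <= u - T - U.
  rewrite -ler_pdivlMr // truncn_le divr_ge0 //; [rewrite /Uh in Uu; lra | exact: ltW].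
have J2 : u - T - U < (J%:R + 1) * L by rewrite -ltr_pdivrMr // natr1; exact: truncnS_gt.
have Jd : log_mass bad (U + J%:R * L) < J%:R * d.
  apply: le_lt_trans (_ : kappa * u < _); first by apply: le_trans bm; apply: log_mass_mono; lra.
  have kL : kappa * (4 * L) = d by rewrite /kappa divfK // gt_eqF //; lra.
  rewrite -kL (_ : J%:R * _ = kappa * (4 * (J%:R * L))); last by ring.
  rewrite ltr_pM2l //; rewrite /Uh in Uu; lra.
have [j jJ block] := pigeonhole_block (@log_mass_ge0 R bad) Jd.
set w := U + j%:R * L in block.
have jL0 : 0 <= j%:R * L by rewrite mulr_ge0 ?ler0n // ltW.
have jL : (j%:R + 1) * L <= J%:R * L by rewrite ler_pM2r // natr1 ler_nat.
have wL : w + L <= u - T by rewrite /w; clear -jL J1; lra.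
have Uw : U <= w by rewrite /w; clear -jL0; lra.
pose good n := ~~ bad n.
have [t [t1 t2 t3]] : exists t : R, [/\ w + k%:R * s <= t, t <= w + k%:R * (H + s) &
    14 / 13 * (t - w) <= log_mass predT (u - w) - log_mass predT (u - t)].
  apply: (@good_chain R u w H s k good) => //.
    (* Without a good [n] in [(t, t + H]], the whole mass there, at least [d], would be bad, against
       the choice of the block. *)
    move=> t wt tk; apply: contrapT => none.
    have := dU t (le_trans Uw wt); rewrite leNgt => /negP; apply.
    apply: le_lt_trans block.
    have tH : t <= t + H by clear -H0; lra.
    apply: (@le_trans _ _ (log_mass bad (t + H) - log_mass bad t)).
      rewrite !log_mass_diff // [X in _ <= X]big_mkcond !big_nat; apply: ler_sum => n /andP[n1 n2].
      case: ifP => // /negbT gn; exfalso; apply: none; exists n => //.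
      have n0 : (0 < n)%N := leq_ltn_trans (leq0n _) n1.
      by rewrite -ltn_efloor // n1 -leq_efloor.
    have : log_mass bad (t + H) <= log_mass bad (w + L) by apply: log_mass_mono; rewrite /L; clear -tk; lra.
    have : log_mass bad w <= log_mass bad t by apply: log_mass_mono.
    move: (log_mass bad _) (log_mass bad _) (log_mass bad _) (log_mass bad _) => b1 b2 b3 b4.
    by clear; lra.
  move=> n r gn n1 n2 /andP[r1 r2].
  have xT : T <= u - ln n%:R by rewrite /L in wL; clear -wL n2 H0; lra.
  move: gn; rewrite /good /bad -ltNge => gn; apply: (density_gain H0 _ gn e'e).
    move=> q /andP[q0 qh]; have := upT (u - ln n%:R + q) (h - q).
    rewrite (_ : u - ln n%:R + q + (h - q) = u - ln n%:R + h); last ring.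
    by apply; [clear -xT q0; lra | rewrite /h; clear -q0 qh; apply/andP; split; lra].
  by rewrite r1.
clear -t1 t3 ks.
have := @log_mass_diff_le R (u - t) (t - w); rewrite (_ : u - t + (t - w) = u - w); last ring.
have ks0 : 0 <= k%:R * s by lra.
by move=> /(_ ltac:(lra)) ?; lra.
Qed.

Lemma log_dense_le (R : realType) (h1 h2 : R) : h1 <= h2 -> log_dense h1 -> log_dense h2.
Proof.
move=> h12 [d d0 [U dU]]; exists d => //; exists U => u Uu.
have := dU u Uu; have : log_mass predT (u + h1) <= log_mass predT (u + h2) by apply: log_mass_mono; lra.
lra.
Qed.

(** Length 25 exceeds the Mertens slack [12 + 12], which starts the induction; [log_dense_step] then
    shrinks the length geometrically. *)
Lemma log_dense_pos (R : realType) (h : R) : 0 < h -> log_dense h.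
Proof.
move=> h0.
have base : log_dense (25 : R).
  exists 1; first lra; exists 0 => u u0.
  have /ler_normlP[? ?] := log_mass_bound u0.
  have /ler_normlP[? ?] : `|log_mass predT (u + 25) - (u + 25)| <= 12.
    by apply: log_mass_bound; lra.
  lra.
have iter n : log_dense ((2 / 3) ^+ n * 25 : R).
  elim: n => [|n IH]; first by rewrite expr0 mul1r.
  rewrite exprS -mulrA; apply: log_dense_step => //.
  by rewrite mulr_gt0 // exprn_gt0 //; lra.
suff [n hn] : exists n, (2 / 3) ^+ n * 25 <= h by exact: log_dense_le (iter n).
have bern n : (2 / 3) ^+ n * (n%:R + 2) <= 2 :> R.
  elim: n => [|n IH]; first by rewrite expr0; lra.
  rewrite exprS -[n.+1%:R]natr1; have := exprn_gt0 n (_ : 0 < 2 / 3 :> R).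
  have : 0 <= n%:R :> R by rewrite ler0n.
  move: IH; move: ((2 / 3) ^+ n) (n%:R) => x y IH y0 /(_ ltac:(lra)) x0.
  have := mulr_ge0 (ltW x0) y0; lra.
pose n := Num.truncn (50 / h); exists n.
have n1 : 50 < (n%:R + 1) * h by rewrite -ltr_pdivrMr // natr1; exact: truncnS_gt.
have := bern n; have : 0 <= n%:R :> R by rewrite ler0n.
have := exprn_gt0 n (_ : 0 < 2 / 3 :> R).
move: ((2 / 3) ^+ n) (n%:R) n1 => x y n1 /(_ ltac:(lra)) x0 y0 b.
have q := ler_wpM2l (ltW x0) (ltW n1).
have : x * (y + 2) * h <= 2 * h by apply: ler_wpM2r => //; exact: ltW.
have := mulr_gt0 x0 h0; lra.
Qed.

(** * Primes in short intervals *)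

Definition proper_prime_power (n : nat) : bool :=
  ~~ prime n && [&& 1 < n & n == pdiv n ^ logn (pdiv n) n]%N.

Lemma proper_prime_powerP n : proper_prime_power n ->
  exists p k, [/\ (1 < p)%N, (1 < k)%N & n = (p ^ k)%N].
Proof.
move=> /andP[np /andP[n1 /eqP nE]]; exists (pdiv n), (logn (pdiv n) n).
have pp := pdiv_prime n1; split=> //; first exact: prime_gt1.
case: (logn _ _) nE => [|[|k]] // nE; first by rewrite nE in n1.
by move: np; rewrite nE expn1 pp.
Qed.

Lemma count_proper_prime_powers (s l : nat) (r : seq nat) : uniq r ->
  (forall p k, (1 < p)%N -> (1 < k)%N -> (p ^ k \in r)%N -> (p <= s)%N && (k <= l)%N) ->
  (count proper_prime_power r <= s.+1 * l.+1)%N.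
Proof.
move=> ur bnd; rewrite -size_filter.
have -> : (s.+1 * l.+1 = size [seq p ^ k | p <- iota 0 s.+1, k <- iota 0 l.+1])%N.
  by rewrite size_allpairs !size_iota.
apply: uniq_leq_size => [|n]; first exact: filter_uniq.
rewrite mem_filter => /andP[/proper_prime_powerP[p [k [p1 k1 ->]]] nr].
by have /andP[ps kl] := bnd p k p1 k1 nr; apply: allpairs_f; rewrite mem_iota.
Qed.

Lemma expR_sixth_ge (R : realType) (v : R) : 0 <= v -> v ^+ 3 <= 216 * expR (v / 6) ^+ 3.
Proof.
move=> v0; have := expR_ge1Dx (v / 6) => E.
have : (v / 6) ^+ 3 <= expR (v / 6) ^+ 3 by apply: lerXn2r; rewrite ?nnegrE ?expR_ge0 //; lra.
by rewrite !exprMn; nra.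
Qed.

(** Without primes in the window, its mass comes from proper powers [p ^ k]. With [v = u + h] these
    have [p <= exp(v / 2)] and [k <= 2 * v], and each weighs at most [v * exp(- u)]; the total
    decays exponentially and drops below [d]. *)
Lemma prime_log_interval (R : realType) (h : R) : 0 < h ->
  exists U : R, forall u : R, U <= u -> exists2 p, prime p & u < ln p%:R <= u + h.
Proof.
move=> h0; have [d d0 [U dU]] := log_dense_pos h0.
(* The final comparison needs [6 * 216 * expR h < v * d], where [6 * 216 = 1296] and 216 comes from
   [expR_sixth_ge]. *)
exists (U + `|U| + 1 + 1300 * expR h / d) => u Uu.
have eh0 := expR_gt0 h.
have q0 : 0 <= 1300 * expR h / d by rewrite divr_ge0 ?mulr_ge0 ?ltW.
have [aU1 aU2] : - `|U| <= U /\ 0 <= `|U| by split=> //; move: (lexx `|U|); rewrite ler_norml => /andP[].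
have u1 : 1 <= u by lra.
apply: contrapT => none; have uU : U <= u by lra.
have := dU u uU; rewrite leNgt => /negP; apply.
set v := u + h; set E := expR (v / 6).
have v1 : 1 <= v by rewrite /v; lra.
have E1 : 1 <= E by rewrite -expR0 ler_expR; lra.
have E6 : E ^+ 6 = expR v by rewrite -expRM_natl; congr expR; field.
rewrite log_mass_diff; last by rewrite /v; lra.
set M := efloor u; set N := efloor v.
have NE : N%:R <= E ^+ 6 by rewrite E6 truncn_le expR_ge0.
have ME : expR u < M.+1%:R by exact: truncnS_gt.
pose s := Num.truncn (E ^+ 3); pose l := Num.truncn (2 * v).
have E30 : 1 <= E ^+ 3 by rewrite exprn_ege1.
have sE : s%:R <= E ^+ 3 by rewrite truncn_le; lra.
have lE : l%:R <= 2 * v by rewrite truncn_le; lra.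
set r := index_iota M.+1 N.+1.
have rP n : n \in r -> [/\ (0 < n)%N, (M < n)%N & (n <= N)%N].
  by rewrite mem_index_iota ltnS => /andP[Mn nN]; split=> //; exact: leq_ltn_trans (leq0n M) Mn.
have lnv n : n \in r -> ln n%:R <= v by move=> /rP[n0 _ nN]; rewrite -leq_efloor.
have cnt : (count proper_prime_power r <= s.+1 * l.+1)%N.
  apply: count_proper_prime_powers; first exact: iota_uniq.
  move=> p k p1 k1 pkr; have [_ _ pkN] := rP _ pkr.
  have pkE : (p ^ k)%:R <= E ^+ 6 by apply: le_trans NE; rewrite ler_nat.
  have -> : (p <= s)%N.
    rewrite truncn_ge_nat; last by clear -E30; lra.
    rewrite -(@ler_pXn2r _ 2) ?nnegrE ?ler0n //; last by clear -E30; lra.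
    rewrite -exprM -natrX; apply: le_trans pkE; rewrite ler_nat.
    by rewrite leq_exp2l.
  rewrite truncn_ge_nat /=; last by clear -v1; lra.
  have := lnv _ pkr; rewrite natrX lnXn; last by rewrite ltr0n ltnW.
  have lnp : 1 / 2 <= ln p%:R :> R.
    have := ln_natS_ge R (ltn0Sn 0); rewrite ln1.
    by have := @ler_ln_nat R 2 p isT p1; clear; lra.
  have : k%:R * (1 / 2) <= k%:R * ln p%:R :> R by apply: ler_wpM2l.
  by rewrite mulr_natl -[_ *+ k]mulr_natl; clear; lra.
have B : \sum_(M.+1 <= n < N.+1) von_mangoldt R n / n%:R <=
   (count proper_prime_power r)%:R * (v * expR (- u)).
  rewrite -sum1_count natr_sum mulr_suml [X in _ <= X]big_mkcond /=.
  rewrite big_seq [X in _ <= X]big_seq; apply: ler_sum => n nr; have [n0 Mn nN] := rP n nr.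
  have un : expR u <= n%:R.
    by apply: ltW; apply: lt_le_trans ME _; rewrite ler_nat.
  have wle : von_mangoldt R n / n%:R <= v * expR (- u).
    apply: ler_pM; [exact: von_mangoldt_ge0 | by rewrite invr_ge0 ler0n | |].
      by apply: le_trans (lnv n nr); apply: von_mangoldt_le.
    by rewrite expRN lef_pV2 ?posrE ?expR_gt0 ?ltr0n.
  case: ifP => [_|]; first by rewrite mul1r.
  rewrite /proper_prime_power /von_mangoldt.
  have -> : prime n = false.
    apply/negP => np; apply: none; exists n => //.
    by rewrite -ltn_efloor // Mn lnv.
  by move=> /= ->; rewrite mul0r.
apply: le_lt_trans B _.
have c1 : (count proper_prime_power r)%:R <= 2 * E ^+ 3 * (3 * v) :> R.
  apply: (@le_trans _ _ (s.+1%:R * l.+1%:R)); first by rewrite -natrM ler_nat.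
  by apply: ler_pM; rewrite ?ler0n // -natr1; clear -sE lE E30 v1; lra.
have w0 : 0 <= v * expR (- u) by rewrite mulr_ge0 ?expR_ge0 //; lra.
apply: le_lt_trans (ler_wpM2r w0 c1) _.
have -> : expR (- u) = expR h / E ^+ 6.
  by rewrite E6 -expRN -expRD; congr expR; rewrite /v; ring.
have c2 := @expR_sixth_ge R v; rewrite -/E in c2.
have E3n : E ^+ 3 != 0 by rewrite gt_eqF //; clear -E30; lra.
have -> : 2 * E ^+ 3 * (3 * v) * (v * (expR h / E ^+ 6)) = 6 * v ^+ 2 * expR h / E ^+ 3.
  rewrite (_ : E ^+ 6 = E ^+ 3 * E ^+ 3); last by rewrite -exprD.
  by move: (E ^+ 3) E3n => c c0; field.
rewrite ltr_pdivrMr; last by clear -E30; lra.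
have vd : 1300 * expR h < v * d.
  by rewrite -ltr_pdivrMr // /v; clear -Uu aU1 h0; lra.
have c3 : v ^+ 3 <= 216 * E ^+ 3 by apply: c2; clear -v1; lra.
have c4 : d * v ^+ 3 <= d * (216 * E ^+ 3) by rewrite ler_pM2l.
have v20 : 0 < v ^+ 2 by rewrite exprn_gt0 //; clear -v1; lra.
have c5 : v ^+ 2 * (1300 * expR h) < v ^+ 2 * (v * d) by rewrite ltr_pM2l.
have c6 : v ^+ 3 = v ^+ 2 * v by ring.
have c7 : 0 < v ^+ 2 * expR h by rewrite mulr_gt0.
rewrite c6 in c4; clear -c4 c5 c7; lra.
Qed.

(** With [r = sqrt H], a prime in [(r + 1, (1 + d / 2) * (r + 1)]] has [p * (p - 1) >= r * r], and
    the upper end is at most [(1 + d) * r] once [r >= 2 / d + 1]. *)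
Lemma prime_near_sqrt (R : realType) (d : R) : 0 < d ->
  exists N0, forall H, (N0 <= H)%N ->
    exists2 p, prime p & (H <= p * p.-1)%N /\ p%:R <= (1 + d) * Num.sqrt H%:R.
Proof.
move=> d0; have h0 : 0 < ln (1 + d / 2) by apply: ln_gt0; lra.
have [U hU] := prime_log_interval h0.
pose B := expR U + 2 / d + 1; have B0 : 0 < B.
  by rewrite /B; have := expR_gt0 U; have : 0 < 2 / d by [rewrite divr_gt0]; lra.
exists (Num.truncn (B ^+ 2)).+1 => H HH.
set r := Num.sqrt H%:R.
have Br : B <= r.
  rewrite -(@ler_pXn2r _ 2) ?nnegrE ?sqrtr_ge0 //; last lra.
  rewrite sqr_sqrtr ?ler0n //; apply: ltW; apply: lt_le_trans (truncnS_gt _) _.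
  by rewrite ler_nat.
have r2 : r * r = H%:R by rewrite -expr2 sqr_sqrtr ?ler0n.
have eU := expR_gt0 U; have d2 : 0 < 2 / d by rewrite divr_gt0.
have rd : 1 + d / 2 <= d / 2 * r.
  have : d / 2 * (2 / d + 1) <= d / 2 * r by apply: ler_wpM2l; [lra | rewrite /B in Br; lra].
  by rewrite mulrDr (_ : d / 2 * (2 / d) = 1); [lra | field; rewrite gt_eqF].
have r10 : 0 < r + 1 by lra.
have [|p pp /andP[p1 p2]] := hU (ln (r + 1)).
  rewrite -(expRK U) ler_ln ?posrE //; rewrite /B in Br; lra.
have p0 : 0 < p%:R :> R by rewrite ltr0n prime_gt0.
rewrite ltr_ln ?posrE // in p1; rewrite -lnM ?posrE // in p2; last lra.
rewrite ler_ln ?posrE // in p2; last by rewrite mulr_gt0 //; lra.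
exists p => //; split; last lra.
rewrite -(ler_nat R) natrM -subn1 natrB ?prime_gt0 // -r2.
by apply: ler_pM; lra.
Qed.

(** * Ruzsa's Sidon sets *)

Lemma Fp_natr_eq (p x y : nat) : prime p ->
  (x%:R == y%:R :> 'F_p) = (x == y %[mod p]).
Proof. by move=> pp; rewrite -val_eqE /= !val_Fp_nat. Qed.

Lemma Fp_primitive_root (p : nat) : prime p -> exists g : 'F_p, p.-1.-primitive_root g.
Proof.
move=> pp; have p1 : (0 < p.-1)%N by rewrite -ltnS prednK ?prime_gt1 ?prime_gt0.
have /hasP[g _ gP] : has p.-1.-primitive_root (enum (predC1 (0 : 'F_p))).
  apply: has_prim_root => //; first last.
  - by rewrite -cardE cardC1 card_Fp.
  - exact: enum_uniq.
  apply/allP => x; rewrite mem_enum => x0.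
  apply/unity_rootP; apply: (mulfI x0).
  have := expf_card x; rewrite (card_Fp pp) => E.
  by rewrite -exprS prednK ?prime_gt0 // mulr1.
by exists g.
Qed.

(** The left side depends on [x] modulo [p], the right side on [x] modulo [p - 1] when [g] is a
    primitive root. *)
Definition ruzsa (p : nat) (g : 'F_p) (x : nat) : bool := x%:R == g ^+ x.

(** Since [x = g ^ x] in the field, the sum of the exponents fixes the product as well as the sum of
    the residues, so both pairs are the roots of one quadratic. Equal residues modulo [p] are equal
    powers of [g], hence equal modulo [p - 1] too. *)
Lemma ruzsa_sidon (p : nat) (g : 'F_p) (x y z w : nat) :
  prime p -> p.-1.-primitive_root g ->
  ruzsa g x -> ruzsa g y -> ruzsa g z -> ruzsa g w ->
  (x + y = z + w)%N ->
  x = z %[mod p * p.-1] \/ x = w %[mod p * p.-1].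
Proof.
move=> pp gP /eqP rx /eqP ry /eqP rz /eqP rw E.
have cop : coprime p p.-1 by rewrite coprimenP ?prime_gt0.
have same a b : a%:R = g ^+ a -> b%:R = g ^+ b -> a%:R = b%:R :> 'F_p -> a = b %[mod p * p.-1].
  move=> ra rb ab; apply/eqP; rewrite chinese_remainder // -Fp_natr_eq // ab eqxx /=.
  by rewrite -(eq_prim_root_expr gP) -ra -rb ab.
have sumE : x%:R + y%:R = z%:R + w%:R :> 'F_p by rewrite -!natrD E.
have prodE : x%:R * y%:R = z%:R * w%:R :> 'F_p by rewrite rx ry rz rw -!exprD E.
have : (x%:R - z%:R) * (x%:R - w%:R) == 0 :> 'F_p.
  have yE : y%:R = z%:R + w%:R - x%:R :> 'F_p by rewrite -sumE addrAC subrr add0r.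
  apply/eqP; move: prodE; rewrite yE.
  move: (x%:R : 'F_p) (z%:R : 'F_p) (w%:R : 'F_p) => a b c prodE.
  by rewrite (_ : _ * _ = b * c - a * (b + c - a)); [rewrite prodE subrr | ring].
by rewrite mulf_eq0 !subr_eq0 => /orP[] /eqP h; [left|right]; apply: same.
Qed.

Lemma ruzsa_mod (p : nat) (g : 'F_p) (x y : nat) : prime p -> p.-1.-primitive_root g ->
  x = y %[mod p * p.-1] -> ruzsa g x = ruzsa g y.
Proof.
move=> pp gP /eqP; rewrite chinese_remainder; last by rewrite coprimenP ?prime_gt0.
rewrite -Fp_natr_eq // -(eq_prim_root_expr gP) => /andP[/eqP h1 /eqP h2].
by rewrite /ruzsa h1 h2.
Qed.

(** For each exponent [i < p - 1] the Chinese remainder theorem gives the member congruent to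
    [g ^ i] and to [i]; distinct [i] need distinct shifts. *)
Lemma ruzsa_translates (p : nat) (g : 'F_p) (x : nat) : prime p -> p.-1.-primitive_root g ->
  (p.-1 <= \sum_(t < p * p.-1) ruzsa g (x + t))%N.
Proof.
move=> pp gP; have p0 := prime_gt0 pp.
have q0 : (0 < p.-1)%N by rewrite -ltnS prednK ?prime_gt1.
have cop : coprime p p.-1 by rewrite coprimenP.
set m := (p * p.-1)%N; have m0 : (0 < m)%N by rewrite muln_gt0 p0.
pose c (i : 'I_p.-1) := chinese p p.-1 (g ^+ i) i.
(* The natural number [m - x %% m] stands for [- x] modulo [m]. *)
pose tt (i : 'I_p.-1) : 'I_m := Ordinal (ltn_pmod (c i + (m - x %% m)) m0).
have xt i : (x + tt i = c i %[mod m])%N.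
  rewrite /= modnDmr -modnDml addnCA subnKC; last by rewrite ltnW // ltn_pmod.
  by rewrite modnDr.
have c1 i : c i = (g ^+ i : 'F_p) %[mod p] by rewrite chinese_modl.
have c2 i : c i = i %[mod p.-1] by rewrite chinese_modr.
have rt i : ruzsa g (x + tt i).
  rewrite (ruzsa_mod pp gP (xt i)) /ruzsa.
  have -> : (c i)%:R = (g ^+ i : 'F_p).
    apply/eqP; rewrite -[X in _ == X]natr_Zp Fp_natr_eq //.
    by apply/eqP; exact: c1.
  by rewrite eq_sym (eq_prim_root_expr gP); apply/eqP; exact: c2.
have inj : injective tt.
  move=> i j eq_t; apply: val_inj => /=.
  have : c i = c j %[mod m] by rewrite -xt eq_t xt.
  move=> /eqP; rewrite chinese_remainder // => /andP[_ /eqP].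
  by rewrite !c2 !modn_small.
have -> : (\sum_(t < m) ruzsa g (x + t) = #|[set t : 'I_m | ruzsa g (x + t)]|)%N.
  by rewrite -sum1dep_card [RHS]big_mkcond; apply: eq_bigr => t _; case: ruzsa.
rewrite -{1}(card_ord p.-1) -(card_imset _ inj); apply: subset_leq_card.
by apply/subsetP => t /imsetP[i _ ->]; rewrite inE rt.
Qed.

(** Averaging: each [x] lies in at least [p - 1] of the [p * (p - 1)] translates, so some translate
    meets [X] in at least [|X| / p] points. Injectivity on [X] lifts congruences to equalities. *)
Lemma sidon_mod_subset (p : nat) (X : {fset nat}) : prime p ->
  {in X &, forall x y, x = y %[mod p * p.-1] -> x = y} ->
  exists S : {fset nat}, [/\ S `<=` X, sidon S & (#|` X| <= #|` S| * p)%N].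
Proof.
move=> pp inj; have [g gP] := Fp_primitive_root pp.
have p0 := prime_gt0 pp.
have q0 : (0 < p.-1)%N by rewrite -ltnS prednK ?prime_gt1.
set m := (p * p.-1)%N in inj *; have m0 : (0 < m)%N by rewrite muln_gt0 p0.
pose S t := [fset x in X | ruzsa g (x + t)].
have [t tP] : exists t, (#|` X| <= #|` S t| * p)%N.
  apply: contrapT => none.
  have lt t : (#|` S t| * p < #|` X|)%N.
    by rewrite ltnNge; apply/negP => h; apply: none; exists t.
  have tot : (#|` X| * p.-1 <= \sum_(t < m) #|` S t|)%N.
    have -> : (\sum_(t < m) #|` S t| = \sum_(x <- X) \sum_(t < m) ruzsa g (x + t))%N.
      rewrite exchange_big; apply: eq_bigr => t _ /=.
      rewrite card_fset_sum1 big_fset /= [LHS]big_mkcond.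
      by apply: eq_bigr => x _; case: ruzsa.
    rewrite card_fset_sum1 big_distrl /=; apply: leq_sum => x _; rewrite mul1n.
    exact: ruzsa_translates.
  have tot2 : (\sum_(t < m) #|` S t| * p <= m * #|` X|.-1)%N.
    rewrite -[X in (_ <= X * _)%N](card_ord m) -sum_nat_const; apply: leq_sum => t _.
    by rewrite -ltnS (leq_trans (lt t)) // leqSpred.
  rewrite -big_distrl /= in tot2.
  have X0 : (0 < #|` X|)%N by apply: leq_ltn_trans (leq0n _) (lt 0%N).
  have : (#|` X| * m <= m * #|` X|.-1)%N.
    have -> : (#|` X| * m = #|` X| * p.-1 * p)%N by rewrite /m (mulnC p) mulnA.
    by apply: leq_trans tot2; rewrite leq_mul2r tot orbT.
  by rewrite mulnC leq_pmul2l // leqNgt prednK // leqnn.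
exists (S t); split=> //; first exact: fset_sub.
move=> a b c d; rewrite !inE /= => /andP[aX ra] /andP[bX rb] /andP[cX rc] /andP[dX rd] E.
have [h|h] : a = c \/ a = d.
- have := @ruzsa_sidon p g (a + t) (b + t) (c + t) (d + t) pp gP ra rb rc rd.
  case=> [|/eqP|/eqP]; first by rewrite addnACA E addnACA.
    by rewrite eqn_modDr => /eqP h; left; exact: inj.
  by rewrite eqn_modDr => /eqP h; right; exact: inj.
- by move: E; rewrite h => /addnI ->.
by move: E; rewrite h addnC => /addIn ->; rewrite fsetUC.
Qed.

(** * Two intervals *)

Lemma leq_max_sidon (S A : {fset nat}) : S `<=` A -> sidon S -> (#|` S| <= max_sidon A)%N.
Proof.
move=> SA sS; rewrite /max_sidon.
apply: (@leq_bigmax_seq _ _ (fun S : {fset nat} => `[< sidon S >]) (fun S => #|` S|) S).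
  by rewrite fpowersetE.
exact/asboolP.
Qed.

Definition segment (a n : nat) : {fset nat} := [fset k in iota a n].

Lemma in_segment (a n k : nat) : (k \in segment a n) = (a <= k < a + n)%N.
Proof. by rewrite inE /= mem_iota. Qed.

Lemma card_segment (a n : nat) : #|` segment a n| = n.
Proof. by rewrite card_fseq undup_id ?iota_uniq // size_iota. Qed.

Lemma segment0 (a : nat) : segment a 0 = fset0.
Proof. by apply/fsetP => k; rewrite in_segment inE; lia. Qed.

Lemma eq_mod_small_dist (m a x y : nat) : (a <= x < a + m)%N -> (a <= y < a + m)%N ->
  x = y %[mod m] -> x = y.
Proof.
move=> /andP[ax xm] /andP[ay ym] /eqP.
rewrite -(subnKC ax) -(subnKC ay) eqn_modDl !modn_small; [by move=> /eqP -> | lia | lia].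
Qed.

Lemma sidon_two_segments (p a1 n1 a2 n2 : nat) : prime p -> (a1 + n1 <= a2)%N ->
  (a2 + n2 - a1 <= p * p.-1)%N ->
  exists S : {fset nat}, [/\ S `<=` segment a1 n1 `|` segment a2 n2, sidon S
    & (n1 + n2 <= #|` S| * p)%N].
Proof.
move=> pp a12 Hm.
have cX : #|` segment a1 n1 `|` segment a2 n2| = (n1 + n2)%N.
  rewrite cardfsU !card_segment (_ : _ `&` _ = fset0) ?cardfs0 ?subn0 //.
  by apply/fsetP => k; rewrite in_fsetI !in_segment inE; lia.
have [x y|S [SX sS cS]] := @sidon_mod_subset p (segment a1 n1 `|` segment a2 n2) pp.
  rewrite !in_fsetU !in_segment => hx hy; apply: (@eq_mod_small_dist _ a1).
    by move: hx; lia.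
  by move: hy; lia.
by exists S; rewrite cX in cS.
Qed.

(** [f] cuts at [b1] and translates the two pieces. The gap separates sums with 0, 1 and 2 terms in
    the second piece, so equal sums of images come from equal sums. *)
Lemma sidon_spread (a1 b1 a2 b2 : nat) (S0 : {fset nat}) :
  (a1 + b1 + maxn b1 b2 <= a2)%N ->
  S0 `<=` segment 0 (b1 + b2) -> sidon S0 ->
  exists S : {fset nat}, [/\ S `<=` segment a1 b1 `|` segment a2 b2, sidon S
    & #|` S| = #|` S0|].
Proof.
move=> gap sub sS0.
pose f x := if (x < b1)%N then (a1 + x)%N else (a2 + (x - b1))%N.
have lt x : x \in S0 -> (x < b1 + b2)%N by move=> /(fsubsetP sub); rewrite in_segment.
have f_inj : {in S0 &, injective f}.
  by move=> x y /lt xb /lt yb; rewrite /f; do 2!case: ltnP => ?; lia.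
have sum_eq x y z w : x \in S0 -> y \in S0 -> z \in S0 -> w \in S0 ->
    (f x + f y = f z + f w)%N -> (x + y = z + w)%N.
  move=> /lt xb /lt yb /lt zb /lt wb; rewrite /f.
  by do 4!case: ltnP => ?; lia.
exists [fset f x | x in S0]; split.
- apply/fsubsetP => _ /imfsetP[x /= /lt xb ->]; rewrite in_fsetU !in_segment /f.
  by case: ltnP => ?; lia.
- move=> a b c d /imfsetP[x /= xS ->] /imfsetP[y /= yS ->].
  move=> /imfsetP[z /= zS ->] /imfsetP[w /= wS ->] E.
  have Exy := sum_eq x y z w xS yS zS wS E.
  have : x \in [fset z; w] by rewrite -(sS0 x y z w) // !inE eqxx.
  rewrite !inE => /orP[/eqP xz|/eqP xw].
    by move: Exy; rewrite xz => /addnI ->.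
  by move: Exy; rewrite xw addnC => /addIn ->; rewrite fsetUC.
by rewrite card_in_imfset.
Qed.

(** The middle conditions say that the gap [H - b1 - b2] is at least [b1] and [b2]. If
    [n2 <= H / 3], keep all of [n2] and take [b1] as large as allowed, for a sum near
    [(H + n2) / 2]; otherwise take thirds of [H]. In the tight case [(43 / 33 + 10 / 43) / 2] barely
    exceeds [33 / 43], and 1500 absorbs the rounding. *)
Lemma balanced_lengths (n1 n2 H : nat) :
  (n2 <= n1)%N -> (43 * (n1 + n2) < 33 * H)%N ->
  (43 * n1 < 33 * (n1 + n2))%N -> (1500 <= n1 + n2)%N ->
  exists b1 b2 : nat, [/\ (b1 <= n1)%N, (b2 <= n2)%N, (2 * b1 + b2 <= H)%N, (b1 + 2 * b2 <= H)%N
    & (33 * (n1 + n2) <= 43 * (b1 + b2))%N].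
Proof.
move=> n21 hH h1 hn; have [le3|lt3] := leqP (3 * n2) H.
  have [c|c] := leqP n1 ((H - n2) %/ 2).
    by exists n1, n2; split=> //; lia.
  by exists ((H - n2) %/ 2)%N, n2; split=> //; lia.
by exists (H %/ 3)%N, (H %/ 3)%N; split; lia.
Qed.

Lemma sidon_two_segments_spread (p a1 n1 a2 n2 b1 b2 : nat) : prime p -> (a1 + n1 <= a2)%N ->
  (b1 <= n1)%N -> (b2 <= n2)%N -> (2 * b1 + b2 <= a2 + n2 - a1)%N ->
  (b1 + 2 * b2 <= a2 + n2 - a1)%N -> (b1 + b2 <= p * p.-1)%N ->
  exists S : {fset nat}, [/\ S `<=` segment a1 n1 `|` segment a2 n2, sidon S
    & (b1 + b2 <= #|` S| * p)%N].
Proof.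
move=> pp a12 bn1 bn2 h1 h2 hp.
have [|S0 [sub0 s0 c0]] := @sidon_two_segments p 0 (b1 + b2) (b1 + b2) 0 pp (leqnn _).
  by rewrite addn0 subn0.
rewrite segment0 fsetU0 in sub0; rewrite addn0 in c0.
(* The first piece starts the first segment and the second piece ends the second one, which
   maximises the gap. *)
have gap : (a1 + b1 + maxn b1 b2 <= a2 + n2 - b2)%N by lia.
have [S [sub sS cS]] := sidon_spread gap sub0 s0.
exists S; rewrite cS; split=> //; apply: fsubset_trans sub _.
by apply/fsubsetP => k; rewrite !in_fsetU !in_segment; lia.
Qed.

Lemma sidon_segments_lower_bound (R : realType) (eps : R) : 0 < eps ->
  exists N, forall a1 n1 a2 n2, (a1 + n1 <= a2)%N -> (N <= n1 + n2)%N ->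
    exists S : {fset nat}, [/\ S `<=` segment a1 n1 `|` segment a2 n2, sidon S
      & (876 / 1000 - eps) * Num.sqrt (n1 + n2)%:R <= #|` S|%:R].
Proof.
move=> eps0; have [N0 hN0] := prime_near_sqrt eps0.
exists (2 * N0 + 1500)%N => a1 n1 a2 n2 a12 nN.
set n := (n1 + n2)%N in nN *; set H := (a2 + n2 - a1)%N.
have nH : (n <= H)%N by rewrite /n /H; lia.
(* The factor [1 + eps] lost on the prime is absorbed because [(876 / 1000 - eps) * (1 + eps) <= 876
   / 1000]. *)
have concl (s : nat) : 876 / 1000 * Num.sqrt n%:R <= s%:R * (1 + eps) ->
    (876 / 1000 - eps) * Num.sqrt n%:R <= s%:R :> R.
  move=> h; have e1 : 0 < 1 + eps by lra.
  rewrite -(ler_pM2r e1); apply: le_trans h.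
  have := sqrtr_ge0 (n%:R : R); move: (Num.sqrt _) => r r0; nra.
have of_length (l s p : nat) : (33 * n <= 43 * l)%N -> (l <= s * p)%N ->
    p%:R <= (1 + eps) * Num.sqrt l%:R :> R -> (876 / 1000 - eps) * Num.sqrt n%:R <= s%:R.
  move=> nl lsp pl; apply: concl.
  have l0 : (0 < l)%N by lia.
  have rl0 : 0 < Num.sqrt l%:R :> R by rewrite sqrtr_gt0 ltr0n.
  (* The comparison of square roots below rests on [(876 / 1000) ^ 2 < 33 / 43]. *)
  have rn0 := sqrtr_ge0 (n%:R : R).
  have rl2 : Num.sqrt l%:R * Num.sqrt l%:R = l%:R :> R by rewrite -expr2 sqr_sqrtr ?ler0n.
  have rn2 : Num.sqrt n%:R * Num.sqrt n%:R = n%:R :> R by rewrite -expr2 sqr_sqrtr ?ler0n.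
  have nlR : 33 * n%:R <= 43 * l%:R :> R by rewrite -!natrM ler_nat.
  have rr : 876 / 1000 * Num.sqrt n%:R <= Num.sqrt l%:R :> R.
    rewrite -(@ler_pXn2r _ 2) ?nnegrE //; [|by rewrite mulr_ge0 //; lra|exact: ltW].
    by rewrite !expr2; nra.
  apply: le_trans rr _; rewrite -(ler_pM2r rl0) rl2.
  apply: (@le_trans _ _ (s%:R * p%:R)); first by rewrite -natrM ler_nat.
  by rewrite -mulrA; apply: ler_wpM2l.
(* Short hull: the whole union is used modulo [p * (p - 1) >= H], giving about [n / sqrt H]
   elements. *)
have [hb|hb] := leqP (33 * H) (43 * n).
  have [|p pp [Hp pH]] := hN0 H; first lia.
  have [S [sub sS cS]] := sidon_two_segments pp a12 Hp.
  exists S; split=> //; apply: concl.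
  have H0 : (0 < H)%N by lia.
  have rH0 : 0 < Num.sqrt H%:R :> R by rewrite sqrtr_gt0 ltr0n.
  have rn0 := sqrtr_ge0 (n%:R : R).
  have rH2 : Num.sqrt H%:R * Num.sqrt H%:R = H%:R :> R by rewrite -expr2 sqr_sqrtr ?ler0n.
  have rn2 : Num.sqrt n%:R * Num.sqrt n%:R = n%:R :> R by rewrite -expr2 sqr_sqrtr ?ler0n.
  have HnR : 33 * H%:R <= 43 * n%:R :> R by rewrite -!natrM ler_nat.
  have rr : 876 / 1000 * Num.sqrt H%:R <= Num.sqrt n%:R :> R.
    rewrite -(@ler_pXn2r _ 2) ?nnegrE //; [|by rewrite mulr_ge0 //; lra].
    by rewrite !expr2; nra.
  rewrite -(ler_pM2r rH0); apply: (@le_trans _ _ n%:R).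
    by rewrite -[X in _ <= X]rn2 mulrAC; apply: ler_wpM2r.
  apply: (@le_trans _ _ (#|` S|%:R * p%:R)); first by rewrite -natrM ler_nat.
  by rewrite -mulrA; apply: ler_wpM2l.
have single a l : (33 * n <= 43 * l)%N -> exists S : {fset nat},
    [/\ S `<=` segment a l, sidon S & (876 / 1000 - eps) * Num.sqrt n%:R <= #|` S|%:R].
  move=> nl; have [|p pp [lp pl]] := hN0 l; first lia.
  have [|S [sub sS cS]] := @sidon_two_segments p a l (a + l) 0 pp (leqnn _).
    by rewrite addn0 addnC addnK.
  rewrite segment0 fsetU0 in sub; rewrite addn0 in cS.
  by exists S; split=> //; apply: of_length pl.
have [h1|h1] := leqP (33 * n) (43 * n1).
  have [S [sub sS cS]] := single a1 n1 h1; exists S; split=> //.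
  exact: fsubset_trans sub (fsubsetUl _ _).
have [h2|h2] := leqP (33 * n) (43 * n2).
  have [S [sub sS cS]] := single a2 n2 h2; exists S; split=> //.
  exact: fsubset_trans sub (fsubsetUr _ _).
have [b1 [b2 [bn1 bn2 q1 q2 q3]]] : exists b1 b2 : nat,
   [/\ (b1 <= n1)%N, (b2 <= n2)%N, (2 * b1 + b2 <= H)%N, (b1 + 2 * b2 <= H)%N
    & (33 * n <= 43 * (b1 + b2))%N].
  have [le|lt] := leqP n2 n1.
    by apply: balanced_lengths => //; rewrite -/n; lia.
  have nE : (n2 + n1 = n)%N by rewrite addnC.
  have := @balanced_lengths n2 n1 H; rewrite nE => /(_ (ltnW lt) hb h2).
  case=> [|b2 [b1 [? ? ? ? ?]]]; first lia.
  by exists b1, b2; split=> //; lia.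
have [|p pp [lp pl]] := hN0 (b1 + b2)%N; first lia.
have [S [sub sS cS]] := sidon_two_segments_spread pp a12 bn1 bn2 q1 q2 lp.
by exists S; split=> //; apply: of_length pl.
Qed.

Lemma disjoint_intervals_segments (I1 I2 : {fset nat}) :
  is_pos_interval I1 -> is_pos_interval I2 -> [disjoint I1 & I2]%fset ->
  exists a1 n1 a2 n2, [/\ I1 `|` I2 = segment a1 n1 `|` segment a2 n2, (a1 + n1 <= a2)%N
    & (n1 + n2 = #|` I1| + #|` I2|)%N].
Proof.
move=> [a [b [_ ->]]] [c [d [_ ->]]].
rewrite /nat_interval -!/(segment _ _) !card_segment.
move: (b.+1 - a)%N (d.+1 - c)%N => m k dis.
have [->|m0] := posnP m.
  (* An empty interval has no position of its own, so it is placed right after the other one. *)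
  by exists c, k, (c + k)%N, 0%N; rewrite !segment0 fset0U fsetU0; split=> //; rewrite addnC.
have [->|k0] := posnP k.
  by exists a, m, (a + m)%N, 0%N; rewrite !segment0 fsetU0.
have notin x : x \in segment a m -> x \in segment c k -> False.
  by move=> h1 h2; have /fdisjointP/(_ x h1) := dis; rewrite h2.
have [le|lt] := leqP (a + m) c; first by exists a, m, c, k.
have [le'|lt'] := leqP (c + k) a.
  by exists c, k, a, m; split=> //; [exact: fsetUC | exact: addnC].
by exfalso; apply: (notin (maxn a c)); rewrite in_segment; lia.
Qed.

Theorem theorem1 (R : realType) (eps : R) (heps : 0 < eps) :
  exists N : nat, forall (I1 I2 : {fset nat}) (n1 n2 : nat),
    is_pos_interval I1 -> is_pos_interval I2 -> [disjoint I1 & I2]%fset ->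
    #|` I1| = n1 -> #|` I2| = n2 -> (N <= n1 + n2)%N ->
    (876 / 1000 - eps) * Num.sqrt (n1 + n2)%:R <= (max_sidon (I1 `|` I2))%:R.
Proof.
have [N hN] := sidon_segments_lower_bound heps; exists N => I1 I2 n1 n2 i1 i2 dis c1 c2 Nn.
have [a1 [m1 [a2 [m2 [UE a12 mE]]]]] := disjoint_intervals_segments i1 i2 dis.
rewrite c1 c2 in mE; rewrite -mE in Nn *.
have [S [sub sS cS]] := hN a1 m1 a2 m2 a12 Nn.
by apply: le_trans cS _; rewrite ler_nat UE; exact: leq_max_sidon.
Qed.
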